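(* There exists a two-dimensional locally finite $CAT(0)$ cubical complex, with a fixed origin vertex, which has exactly two profiles and exactly one point in its boundary at infinity.
   Context: Let $M$ be a locally finite $CAT(0)$ cubical complex with a fixed origin (a vertex) $O$. For a hyperplane $H$ of $M$, $H^+$ denotes the half-space determined by $H$ not containing $O$. Hyperplanes are partially ordered by $H_1\le H_2$ iff $H_2^+\subseteq H_1^+$. A profile is a non-empty collection $\mathcal P$ of hyperplanes such that: (i) for any finite subset $\{H_1,\dots,H_n\}$ of $\mathcal P$, $H_1^+\cap\dots\cap H_n^+\ne\emptyset$; (ii) the poset $(\mathcal P,\le)$ has no maximal elements; (iii) if $H_1\in\mathcal P$ and $H_2\le H_1$, then $H_2\in\mathcal P$. The boundary at infinity is the set of asymptoty classes of geodesic rays. *)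

(* Defs.v *)
From HB Require Import structures.
From Stdlib Require Import Relation_Operators.
From mathcomp Require Import all_boot all_order all_algebra.
From mathcomp Require Import all_classical all_reals all_analysis.

Set Implicit Arguments.
Unset Strict Implicit.
Unset Printing Implicit Defensive.

Import Order.TTheory GRing.Theory Num.Theory.
Import numFieldNormedType.Exports.

Local Open Scope classical_set_scope.
Local Open Scope ring_scope.

(* The library norm on 'rV[R]_n is the sup norm, hence this definition. *)
Definition eucl_dist (R : realType) (n : nat) (x y : 'rV[R]_n) : R :=
  Num.sqrt (\sum_(i < n) (x ord0 i - y ord0 i) ^+ 2).

Definition unit_cube (R : realType) (n : nat) : set 'rV[R]_n :=
  [set x | forall i, 0 <= x ord0 i <= 1].

(* The face on which the coordinates i with f i = Some b are frozen to b. *)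
Definition cube_face (R : realType) (n : nat) (f : 'I_n -> option bool) :
    set 'rV[R]_n :=
  [set x | unit_cube x /\ forall i b, f i = Some b -> x ord0 i = b%:R].

Definition is_face (R : realType) (n : nat) (F : set 'rV[R]_n) : Prop :=
  exists f : 'I_n -> option bool, F = cube_face f.

(* String from x to y of length l: finitely many points, starting at x and
   ending at y, consecutive points lying in a common cube; l is the sum of the
   Euclidean distances, measured in these cubes, of consecutive points. *)
Inductive string (R : realType) (M I : Type) (dim : I -> nat)
    (chart : forall c : I, 'rV[R]_(dim c) -> M) : M -> M -> R -> Prop :=
| string_nil (x : M) : string chart x x 0
| string_cons (c : I) (u v : 'rV[R]_(dim c)) (z : M) (l : R) :
    unit_cube u -> unit_cube v -> string chart (chart c v) z l ->
    string chart (chart c u) z (eucl_dist u v + l).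

(* Cubical complex structure on a metric space M, after Bridson and Haefliger,
   Metric Spaces of Non-Positive Curvature, I.7.32: M is obtained from a
   disjoint union of unit cubes by gluing faces isometrically, and it carries
   the intrinsic metric.  The values of a chart outside the unit cube are
   irrelevant. Faces of cubes are themselves required to be cubes. *)
Record cubical_complex (R : realType) (M : metricType R) := CubicalComplex {
  cube : Type;
  dim : cube -> nat;
  chart : forall c : cube, 'rV[R]_(dim c) -> M;
  cube_cover : forall x : M, exists c (u : 'rV[R]_(dim c)),
    unit_cube u /\ chart u = x;
  chart_inj : forall c (u v : 'rV[R]_(dim c)),
    unit_cube u -> unit_cube v -> chart u = chart v -> u = v;
  cube_glue : forall c c',
    chart (c := c) @` @unit_cube R _ `&` chart (c := c') @` @unit_cube R _
      !=set0 ->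
    exists (F : set 'rV[R]_(dim c)) (F' : set 'rV[R]_(dim c'))
           (h : 'rV[R]_(dim c) -> 'rV[R]_(dim c')),
      [/\ is_face F, is_face F', h @` F = F',
          forall u v, F u -> F v -> eucl_dist (h u) (h v) = eucl_dist u v &
          forall u u', unit_cube u -> unit_cube u' ->
            (chart u = chart u' <-> F u /\ u' = h u)];
  cube_faces : forall c (F : set 'rV[R]_(dim c)), is_face F ->
    exists c', chart (c := c') @` @unit_cube R _ = chart (c := c) @` F;
  (* In \bar R, so that any two points of M are joined by a string. *)
  intrinsic_metric : forall x y : M,
    (mdist x y)%:E = ereal_inf [set l%:E | l in string chart x y]
}.

Definition cell (R : realType) (M : metricType R) (K : cubical_complex M)
    (c : cube K) : set M := chart (c := c) @` @unit_cube R _.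

Definition is_vertex (R : realType) (M : metricType R) (K : cubical_complex M)
    (x : M) : Prop := exists c : cube K, dim c = 0%N /\ cell c = [set x].

Definition two_dimensional (R : realType) (M : metricType R)
    (K : cubical_complex M) : Prop :=
  (forall c : cube K, (dim c <= 2)%N) /\ exists c : cube K, dim c = 2%N.

Definition locally_finite (R : realType) (M : metricType R)
    (K : cubical_complex M) : Prop :=
  forall x : M, finite_set [set A | (exists c : cube K, A = cell c) /\ A x].

Definition geodesic (R : realType) (M : metricType R) (p q : M) (g : R -> M) :
    Prop :=
  [/\ g 0 = p, g (mdist p q) = q &
      forall s t, 0 <= s <= mdist p q -> 0 <= t <= mdist p q ->
        mdist (g s) (g t) = `|s - t|].

(* x' is a comparison point in [p', q'] for the point x on the side g of a
   geodesic triangle.  If p = q, the division by 0 is harmless. *)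
Definition comparison_point (R : realType) (M : metricType R) (p q : M)
    (g : R -> M) (p' q' : 'rV[R]_2) (x : M) (x' : 'rV[R]_2) : Prop :=
  exists t, [/\ 0 <= t <= mdist p q, x = g t &
                x' = p' + (t / mdist p q) *: (q' - p')].

Definition CAT0 (R : realType) (M : metricType R) : Prop :=
  (forall p q : M, exists g, geodesic p q g) /\
  forall (p q r : M) (a b c : R -> M),
    geodesic p q a -> geodesic q r b -> geodesic r p c ->
  forall p' q' r' : 'rV[R]_2,
    eucl_dist p' q' = mdist p q -> eucl_dist q' r' = mdist q r ->
    eucl_dist r' p' = mdist r p ->
  let comparison x x' :=
    [\/ comparison_point p q a p' q' x x', comparison_point q r b q' r' x x' |
        comparison_point r p c r' p' x x'] in
  forall x x' y y', comparison x x' -> comparison y y' ->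
    mdist x y <= eucl_dist x' y'.

Definition geodesic_ray (R : realType) (M : metricType R) (g : R -> M) : Prop :=
  forall s t, 0 <= s -> 0 <= t -> mdist (g s) (g t) = `|s - t|.

Definition asymptotic (R : realType) (M : metricType R) (g g' : R -> M) : Prop :=
  exists C, forall t, 0 <= t -> mdist (g t) (g' t) <= C.

(* Each class contains, with a ray, all functions R -> M that agree with it on
   [0, +oo[, so values at negative reals do not create new points. *)
Definition boundary_at_infinity (R : realType) (M : metricType R) :
    set (set (R -> M)) :=
  [set C | exists2 g, geodesic_ray g &
             C = [set g' | geodesic_ray g' /\ asymptotic g g']].

Arguments boundary_at_infinity {R} M.

Definition midcube (R : realType) (M : metricType R) (K : cubical_complex M)
    (c : cube K) (i : 'I_(dim c)) : set M :=
  chart (c := c) @` [set u | unit_cube u /\ u ord0 i = 2^-1].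

Definition is_midcube (R : realType) (M : metricType R) (K : cubical_complex M)
    (A : set M) : Prop := exists (c : cube K) (i : 'I_(dim c)), A = midcube i.

(* A midcube is contained in another one exactly when it is a face of it. *)
Definition midcube_face (R : realType) (M : metricType R)
    (K : cubical_complex M) (A B : set M) : Prop :=
  [/\ is_midcube K A, is_midcube K B & A `<=` B].

Definition hyperplane (R : realType) (M : metricType R) (K : cubical_complex M)
    (H : set M) : Prop :=
  exists2 A, is_midcube K A &
    H = \bigcup_(B in clos_refl_sym_trans _ (midcube_face K) A) B.

Definition half_space (R : realType) (M : metricType R) (H S : set M) : Prop :=
  exists2 x, ~ H x & S = connected_component (~` H) x.

(* H^+: a hyperplane H of a CAT(0) cubical complex has exactly two half-spaces
   and does not contain the vertex O, so this is a union of a single set. *)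
Definition half_space_plus (R : realType) (M : metricType R) (O : M)
    (H : set M) : set M :=
  \bigcup_(S in [set S | half_space H S /\ ~ S O]) S.

Definition hyperplane_le (R : realType) (M : metricType R) (O : M)
    (H1 H2 : set M) : Prop :=
  half_space_plus O H2 `<=` half_space_plus O H1.

Definition profile (R : realType) (M : metricType R) (K : cubical_complex M)
    (O : M) (P : set (set M)) : Prop :=
  [/\ P !=set0 /\ (forall H, P H -> hyperplane K H),
      forall F : set (set M), finite_set F -> F `<=` P ->
        \bigcap_(H in F) half_space_plus O H !=set0,
      ~ exists2 H, P H & forall H', P H' -> hyperplane_le O H H' -> H' = H &
      forall H1 H2, P H1 -> hyperplane K H2 -> hyperplane_le O H2 H1 -> P H2].

(* Main.v *)
(** The complex is the staircase [{(x, y) | 0 <= x, 0 <= y <= ht (floor x)}] in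
the plane, tiled by unit squares, with its length metric and origin (0, 0);
[ht] is nondecreasing, unbounded and [o(x)].

The hyperplanes are the lines x = n + 1/2 and y = k + 1/2.  Since [ht] is
unbounded, every vertical one is below some horizontal one, and no horizontal
one is below a vertical one; so the profiles are the set of all vertical
hyperplanes and the set of all hyperplanes.

A geodesic is straight in each column [n, n+1] x [0, ht n] and turns only
upwards, at the top of the left side of a column.  CAT(0) follows from Stewart's
inequality, that is, from the convexity of t |-> d(p, g t)^2 - t^2 along geodesics
g.  In a column this holds because d(p, -) is a supremum of Euclidean distances
|- - v| to virtual sources v, obtained by propagating from column to column; at a
turning point the sources for the two sides can be chosen so that the one-sided
derivatives are in the right order.

By CAT(0) the height is convex along a geodesic ray; as it is [o(t)], it is
nonincreasing, so every ray is asymptotic to the horizontal axis. *)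

Require Import Defs.
From HB Require Import structures.
From Stdlib Require Import Relation_Operators.
From mathcomp Require Import all_boot all_order all_algebra ring lra zify.
From mathcomp Require Import all_classical all_reals all_analysis.

Set Implicit Arguments.
Unset Strict Implicit.
Unset Printing Implicit Defensive.

Import Order.TTheory GRing.Theory Num.Theory.
Import numFieldNormedType.Exports.

Local Open Scope classical_set_scope.
Local Open Scope ring_scope.

(** * Plane geometry *)

Section Plane.
Variable R : realType.
Implicit Types (p q a b c m v z : R * R) (s t : R).

(** The distance from [p] has no convenient closed formula, so it is handled through supports: at a
    point [m] of a column, the Euclidean distance to some point of the plane touches [sd p] from
    below, and Stewart's identity for that distance gives the inequality. A support can be carried
    past a line because a shortest path crosses the line at a minimiser, where a first-order
    condition holds. Derivatives appear only as bounds with an error [t * K].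

    Hence convexity is shown for one geodesic per pair of points, built column by column. It makes
    the point at given distances from the two ends unique, and so yields Stewart's inequality for
    every point between them. *)

Lemma le_of_small_error (A B K : R) :
  (forall t, 0 < t <= 1 -> A <= B + t * K) -> A <= B.
Proof.
move=> H; rewrite leNgt; apply/negP => BA.
(* With this [t] the error [t * K] is at most half of [A - B]. *)
pose t := (A - B) / (2 * (`|K| + (A - B))).
have K0 : 0 <= `|K| by [].
have D0 : 0 < 2 * (`|K| + (A - B)) by lra.
have t0 : 0 < t by rewrite /t divr_gt0 //; lra.
have t1 : t <= 1 by rewrite /t ler_pdivrMr // mul1r; lra.
have := H t; rewrite t0 t1 => /(_ isT).
have KK : K <= `|K| by exact: ler_norm.
have E : t * (2 * (`|K| + (A - B))) = A - B by rewrite /t divfK // gt_eqF.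
have : t * K <= t * `|K| by rewrite ler_pM2l.
have : 0 <= t * (A - B) by rewrite mulr_ge0 ?ltW //; lra.
by lra.
Qed.

Definition clamp (a b t : R) := Num.max a (Num.min t b).

Lemma clampP (a b t : R) : a <= b -> a <= clamp a b t <= b.
Proof.
by move=> ab; rewrite /clamp /Order.min /Order.max; case: ifP; case: ifP; lra.
Qed.

Lemma clamp_lipschitz (a b s t : R) : `|clamp a b s - clamp a b t| <= `|s - t|.
Proof.
have A : s - t <= `|s - t| by exact: ler_norm.
have B : t - s <= `|s - t| by rewrite distrC ler_norm.
rewrite ler_norml /clamp /Order.min /Order.max.
by do 4 (case: ifP); lra.
Qed.

Lemma clamp_id (a b t : R) : a <= t <= b -> clamp a b t = t.
Proof. by rewrite /clamp /Order.min /Order.max; case: ifP; case: ifP; lra. Qed.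

Definition sqd p q : R := (p.1 - q.1) ^+ 2 + (p.2 - q.2) ^+ 2.
Definition ed p q : R := Num.sqrt (sqd p q).

Lemma sqd_ge0 p q : 0 <= sqd p q.
Proof. by rewrite addr_ge0 // sqr_ge0. Qed.

Lemma sqdC p q : sqd p q = sqd q p.
Proof. by rewrite /sqd; ring. Qed.

Lemma edC p q : ed p q = ed q p.
Proof. by rewrite /ed sqdC. Qed.

Lemma ed_ge0 p q : 0 <= ed p q.
Proof. exact: sqrtr_ge0. Qed.

Lemma sqr_ed p q : ed p q ^+ 2 = sqd p q.
Proof. by rewrite sqr_sqrtr // sqd_ge0. Qed.

Lemma ed_eq p q t : 0 <= t -> sqd p q = t ^+ 2 -> ed p q = t.
Proof. by move=> t0 E; rewrite /ed E sqrtr_sqr ger0_norm. Qed.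

Lemma edxx p : ed p p = 0.
Proof. by apply: ed_eq => //; rewrite /sqd; ring. Qed.

Lemma sqd_eq0 p q : sqd p q = 0 -> p = q.
Proof.
move/eqP; rewrite paddr_eq0 ?sqr_ge0 // !sqrf_eq0 !subr_eq0.
by case: p q => [? ?] [? ?] /= /andP[/eqP -> /eqP ->].
Qed.

Lemma ed_eq0 p q : ed p q = 0 -> p = q.
Proof. by move=> E; apply: sqd_eq0; rewrite -sqr_ed E expr0n. Qed.

Lemma ed_gt0 p q : p <> q -> 0 < ed p q.
Proof. by move=> pq; rewrite lt_def ed_ge0 andbT; apply/eqP => /ed_eq0. Qed.

Lemma ed_le p q t : 0 <= t -> sqd p q <= t ^+ 2 -> ed p q <= t.
Proof. by move=> t0; rewrite -sqr_ed ler_sqr // nnegrE ed_ge0. Qed.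

Lemma le_ed p q t : t ^+ 2 <= sqd p q -> t <= ed p q.
Proof.
move=> H; case: (leP 0 t) => t0; last exact: le_trans (ltW t0) (ed_ge0 _ _).
by move: H; rewrite -sqr_ed ler_sqr // nnegrE ed_ge0.
Qed.

Lemma le_ed1 p q : `|p.1 - q.1| <= ed p q.
Proof. by apply: le_ed; rewrite real_normK ?num_real // /sqd lerDl sqr_ge0. Qed.

Lemma le_ed2 p q : `|p.2 - q.2| <= ed p q.
Proof. by apply: le_ed; rewrite real_normK ?num_real // /sqd lerDr sqr_ge0. Qed.

Lemma ed_horizontal p q : p.2 = q.2 -> ed p q = `|p.1 - q.1|.
Proof.
by move=> E; apply: ed_eq => //; rewrite real_normK ?num_real // /sqd E; ring.
Qed.

Lemma ed_vertical p q : p.1 = q.1 -> ed p q = `|p.2 - q.2|.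
Proof.
by move=> E; apply: ed_eq => //; rewrite real_normK ?num_real // /sqd E; ring.
Qed.

Lemma dot_le_ed p q a b :
  (p.1 - q.1) * (a.1 - b.1) + (p.2 - q.2) * (a.2 - b.2) <= ed p q * ed a b.
Proof.
set l := (X in X <= _); case: (leP 0 l) => l0; last first.
  by apply: le_trans (ltW l0) _; rewrite mulr_ge0 ?ed_ge0.
rewrite -ler_sqr ?nnegrE ?mulr_ge0 ?ed_ge0 // exprMn !sqr_ed /sqd /l.
set x := p.1 - q.1; set y := p.2 - q.2; set x' := a.1 - b.1; set y' := a.2 - b.2.
by rewrite -subr_ge0 (_ : _ - _ = (x * y' - y * x') ^+ 2) ?sqr_ge0 //; ring.
Qed.

Lemma ed_triangle p q m : ed p q <= ed p m + ed m q.
Proof.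
apply: ed_le; first by rewrite addr_ge0 ?ed_ge0.
have H := dot_le_ed p m m q; rewrite sqrrD !sqr_ed /sqd.
by move: H; rewrite /sqd; nra.
Qed.

(** First variation of the distance to [a], as a one-sided bound: the square root lies below its
    tangent at [B ^+ 2], because [(ed X a - B) ^+ 2] is nonnegative. *)
Lemma ed_move_le m a (e1 e2 t : R) : m <> a ->
  ed (m.1 + t * e1, m.2 + t * e2) a <=
  ed m a + t * ((m.1 - a.1) * e1 + (m.2 - a.2) * e2) / ed m a
  + t ^+ 2 * (e1 ^+ 2 + e2 ^+ 2) / (2 * ed m a).
Proof.
move=> ma; set B := ed m a; have B0 : 0 < B := ed_gt0 ma.
have BB : B ^+ 2 = sqd m a := sqr_ed m a.
set X := (X in ed X a).
have -> : B + t * ((m.1 - a.1) * e1 + (m.2 - a.2) * e2) / B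
  + t ^+ 2 * (e1 ^+ 2 + e2 ^+ 2) / (2 * B) = (B ^+ 2 + sqd X a) / (2 * B).
  have -> : sqd X a = B ^+ 2 + 2 * t * ((m.1 - a.1) * e1 + (m.2 - a.2) * e2)
      + t ^+ 2 * (e1 ^+ 2 + e2 ^+ 2) by rewrite BB /sqd /X /=; ring.
  by field; rewrite gt_eqF.
rewrite ler_pdivlMr ?mulr_gt0 // -sqr_ed.
have := sqr_ge0 (ed X a - B); lra.
Qed.

(** Equality in the triangle inequality forces equality in Cauchy-Schwarz, so the vector
    [y (z - a) - x (c - z)] has norm zero. Keeping the weights undivided allows coinciding
    points. *)
Lemma segment_of_ed_eq a z c : ed a z + ed z c <= ed a c ->
  (ed a z + ed z c) * z.1 = ed z c * a.1 + ed a z * c.1 /\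
  (ed a z + ed z c) * z.2 = ed z c * a.2 + ed a z * c.2.
Proof.
move=> H; set x := ed a z; set y := ed z c.
have x0 : 0 <= x := ed_ge0 a z.
have y0 : 0 <= y := ed_ge0 z c.
have : (x + y) ^+ 2 <= sqd a c.
  by rewrite -sqr_ed ler_sqr ?nnegrE ?addr_ge0 ?ed_ge0.
have Ex : x ^+ 2 = sqd a z := sqr_ed a z.
have Ey : y ^+ 2 = sqd z c := sqr_ed z c.
rewrite sqrrD Ex Ey => H2.
have H3 : x * y <= (z.1 - a.1) * (c.1 - z.1) + (z.2 - a.2) * (c.2 - z.2).
  by move: H2; rewrite /sqd; nra.
have H4 : (y * (z.1 - a.1) - x * (c.1 - z.1)) ^+ 2 +
          (y * (z.2 - a.2) - x * (c.2 - z.2)) ^+ 2 <= 0.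
  have -> : (y * (z.1 - a.1) - x * (c.1 - z.1)) ^+ 2 +
          (y * (z.2 - a.2) - x * (c.2 - z.2)) ^+ 2 =
    y ^+ 2 * sqd a z + x ^+ 2 * sqd z c - 2 * (x * y) *
    ((z.1 - a.1) * (c.1 - z.1) + (z.2 - a.2) * (c.2 - z.2)).
    by rewrite /sqd; ring.
  rewrite -Ex -Ey.
  have := ler_wpM2l (mulr_ge0 x0 y0) H3; lra.
have [E1 E2] : y * (z.1 - a.1) - x * (c.1 - z.1) = 0 /\
  y * (z.2 - a.2) - x * (c.2 - z.2) = 0.
  have s1 := sqr_ge0 (y * (z.1 - a.1) - x * (c.1 - z.1)).
  have s2 := sqr_ge0 (y * (z.2 - a.2) - x * (c.2 - z.2)).
  by split; apply/eqP; rewrite -sqrf_eq0; apply/eqP; lra.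
by split; lra.
Qed.

Lemma stewart_sqd a z c v (x y : R) :
  (x + y) * z.1 = y * a.1 + x * c.1 -> (x + y) * z.2 = y * a.2 + x * c.2 ->
  (x + y) ^+ 2 * sqd z v =
  (x + y) * (y * sqd a v + x * sqd c v) - x * y * sqd a c.
Proof.
move=> E1 E2.
have -> : (x + y) ^+ 2 * sqd z v =
  ((x + y) * z.1 - (x + y) * v.1) ^+ 2 + ((x + y) * z.2 - (x + y) * v.2) ^+ 2.
  by rewrite /sqd; ring.
by rewrite E1 E2 /sqd; ring.
Qed.

(* Angles: with w1 = -(cos r, sin r), w2 = (cos r', sin r') and
   u = D (cos s, sin s), all angles in [-pi/2, pi/2] and r <= r', the vector u'
   is D (cos t, sin t) with t = max(r', s), and |t - r'| <= |s - r|. *)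
Lemma turn_source (D w1x w1y w2x w2y ux uy : R) : 0 <= D ->
  w1x ^+ 2 + w1y ^+ 2 = 1 -> w2x ^+ 2 + w2y ^+ 2 = 1 ->
  ux ^+ 2 + uy ^+ 2 = D ^+ 2 -> w1x <= 0 -> 0 <= w2x -> 0 <= ux ->
  0 <= w1y + w2y ->
  exists u'x u'y, [/\ u'x ^+ 2 + u'y ^+ 2 = D ^+ 2, uy <= u'y &
    0 <= (ux * w1x + uy * w1y) + (u'x * w2x + u'y * w2y)].
Proof.
move=> D0 N1 N2 NU w1 w2 u0 w12.
(* If [u] points below [w2], then [u'] is [D] times [w2], whose product with [w2] is [D]; by
   Cauchy-Schwarz the other term is at least [- D]. Otherwise [u'] is [u]. *)
case: (leP uy (D * w2y)) => H.
  exists (D * w2x), (D * w2y); split => //.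
    by rewrite !exprMn -mulrDr N2 mulr1.
  have -> : D * w2x * w2x + D * w2y * w2y = D.
    by rewrite -!mulrA -!expr2 -mulrDr N2 mulr1.
  have : (ux * w1x + uy * w1y) ^+ 2 <= D ^+ 2.
    rewrite -[D ^+ 2]mulr1 -NU -N1 -subr_ge0.
    rewrite (_ : _ - _ = (ux * w1y - uy * w1x) ^+ 2) ?sqr_ge0 //; ring.
  rewrite -[_ ^+ 2]real_normK ?num_real // ler_sqr ?nnegrE // => /ler_normlP[].
  lra.
exists ux, uy; split => //.
(* A cross product with known sign: [u] has at least the angle of [(c, s)], and both lie in the
   right half-plane. *)
have cross (c s : R) : 0 <= c -> c ^+ 2 + s ^+ 2 = 1 -> D * s <= uy ->
    s * ux <= uy * c.
  move=> c0 N Hs.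
  have E : (uy * c) ^+ 2 - (s * ux) ^+ 2 = uy ^+ 2 - (D * s) ^+ 2.
    apply/eqP; rewrite -subr_eq0; apply/eqP.
    transitivity (uy ^+ 2 * (c ^+ 2 + s ^+ 2 - 1)
      + s ^+ 2 * (D ^+ 2 - (ux ^+ 2 + uy ^+ 2))); first by ring.
    by rewrite N NU !subrr !mulr0 addr0.
  case: (leP 0 s) => s0.
    have Ds : 0 <= D * s by rewrite mulr_ge0.
    rewrite -ler_sqr ?nnegrE ?mulr_ge0 //; last exact: le_trans Ds Hs.
    rewrite -subr_ge0 E subr_ge0 ler_sqr // nnegrE //; exact: le_trans Ds Hs.
  case: (leP 0 uy) => uy0.
    by apply: le_trans (mulr_ge0 uy0 c0); rewrite nmulr_rle0.
  rewrite -lerN2 -ler_sqr ?nnegrE; last 2 first.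
  - by rewrite oppr_ge0 nmulr_rle0.
  - by rewrite oppr_ge0 nmulr_rle0.
  rewrite !sqrrN -subr_ge0 -opprB oppr_ge0 E subr_le0.
  by rewrite -[uy ^+ 2]sqrrN -[(D * s) ^+ 2]sqrrN ler_sqr ?nnegrE; lra.
have Hs1 : D * (- w1y) <= uy by apply: le_trans (ltW H); apply: ler_wpM2l; lra.
have c1 := cross (- w1x) (- w1y); rewrite !sqrrN in c1.
have {}c1 := c1 ltac:(lra) N1 Hs1.
have c2 := cross w2x w2y w2 N2 (ltW H).
(* Both directions are vertical here, and the factor [w2x - w1x] used below vanishes. *)
have [z|z] := eqVneq (w2x - w1x) 0.
  have [-> ->] : w1x = 0 /\ w2x = 0 by split; lra.
  rewrite !mulr0 !add0r -mulrDr; case: (leP 0 uy) => uy0; first exact: mulr_ge0.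
  have w1y1 : w1y ^+ 2 = 1 by have -> : w1y ^+ 2 = w1x ^+ 2 + w1y ^+ 2; nra.
  have w2y1 : w2y ^+ 2 = 1 by nra.
  have D1 : D ^+ 2 = ux ^+ 2 + uy ^+ 2 by [].
  suff -> : w1y + w2y = 0 by rewrite mulr0.
  have : (w1y - w2y) * (w1y + w2y) = 0 by rewrite -subr_sqr w1y1 w2y1 subrr.
  move/eqP; rewrite mulf_eq0 => /orP[/eqP E|/eqP //].
  have e : w1y = w2y by lra.
  rewrite -e in w12 H; have w1y0 : 0 <= w1y by lra.
  nra.
have P : 0 < w2x - w1x by rewrite lt_def z /=; lra.
(* As [w1] and [w2] are unit vectors, [w1 + w2] is orthogonal to [w2 - w1]; so its product with [u]
   reduces to the two cross products just bounded. *)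
rewrite -(pmulr_rge0 _ P).
have -> : (w2x - w1x) * (ux * w1x + uy * w1y + (ux * w2x + uy * w2y)) =
  (w1y + w2y) * ((uy * - w1x - - w1y * ux) + (uy * w2x - w2y * ux))
  + ux * ((w2x ^+ 2 + w2y ^+ 2) - (w1x ^+ 2 + w1y ^+ 2)).
  by ring.
rewrite N1 N2 subrr mulr0 addr0 mulr_ge0 //; lra.
Qed.

(** The mirror image of [turn_source] in a vertical axis, which exchanges [w1] and [w2]. *)
Lemma turn_sourceN (D w1x w1y w2x w2y ux uy : R) : 0 <= D ->
  w1x ^+ 2 + w1y ^+ 2 = 1 -> w2x ^+ 2 + w2y ^+ 2 = 1 ->
  ux ^+ 2 + uy ^+ 2 = D ^+ 2 -> w1x <= 0 -> 0 <= w2x -> ux <= 0 ->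
  0 <= w1y + w2y ->
  exists u'x u'y, [/\ u'x ^+ 2 + u'y ^+ 2 = D ^+ 2, uy <= u'y &
    0 <= (u'x * w1x + u'y * w1y) + (ux * w2x + uy * w2y)].
Proof.
move=> D0 N1 N2 NU w1 w2 u0 w12.
have [||||||||x [y [A B C]]] := @turn_source D (- w2x) w2y (- w1x) w1y (- ux) uy.
- by [].
- by rewrite sqrrN.
- by rewrite sqrrN.
- by rewrite sqrrN.
- by lra.
- by lra.
- by lra.
- by lra.
by exists (- x), y; split => //; [rewrite sqrrN|lra].
Qed.

End Plane.

(** * Convexity through three-point inequalities *)

Section Convexity.
Variable R : realType.
Implicit Types (F : R -> R) (a b c d x y z e : R).

Definition cvx3 F x y z := (z - x) * F y <= (z - y) * F x + (y - x) * F z.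

Definition cvx_on F a b :=
  forall x y z, a <= x -> x < y -> y < z -> z <= b -> cvx3 F x y z.

Lemma cvx3_left F x y e z : x < y -> y < e -> e < z ->
  cvx3 F x y e -> cvx3 F y e z -> cvx3 F x y z.
Proof.
rewrite /cvx3 => xy ye ez H1 H2.
have ey : 0 < e - y by rewrite subr_gt0.
rewrite -(ler_pM2l ey).
have zy : 0 <= z - y by lra.
have yx : 0 <= y - x by lra.
have := ler_wpM2l zy H1; have := ler_wpM2l yx H2; lra.
Qed.

Lemma cvx3_right F x y e z : x < y -> y < e -> e < z ->
  cvx3 F x y e -> cvx3 F y e z -> cvx3 F x e z.
Proof.
rewrite /cvx3 => xy ye ez H1 H2.
have ey : 0 < e - y by rewrite subr_gt0.
rewrite -(ler_pM2l ey).
have ze : 0 <= z - e by lra.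
have ex : 0 <= e - x by lra.
have := ler_wpM2l ze H1; have := ler_wpM2l ex H2; lra.
Qed.

(** A triple that straddles [b] without having it in the middle follows from one triple centred at
    [b] and one on a single side. *)
Lemma cvx_on_glue F a b c : cvx_on F a b -> cvx_on F b c ->
  (forall x z, a <= x -> x < b -> b < z -> z <= c -> cvx3 F x b z) ->
  cvx_on F a c.
Proof.
move=> H1 H2 H x y z ax xy yz zc.
case: (leP z b) => zb; first exact: H1.
case: (leP b x) => bx; first exact: H2.
case: (ltgtP y b) => [yb|by_|->].
- apply: (@cvx3_left _ _ _ b) => //; first exact: H1.
  by apply: H => //; lra.
- apply: (@cvx3_right _ _ b) => //; last exact: H2.
  by apply: H => //; lra.
- exact: H.
Qed.

(** Convexity is local: triples centred at [c] with both ends in [[b, d]] are known, and a left end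
    before [b] is reached through [b]. *)
Lemma cvx_on_overlap F a b c d : a <= b -> b < c -> c <= d ->
  cvx_on F a c -> cvx_on F b d -> cvx_on F a d.
Proof.
move=> ab bc cd H1 H2; have H3 : cvx_on F b c.
  by move=> x y z bx xy yz zc; apply: H1 => //; lra.
apply: (@cvx_on_glue _ _ c) => //.
  by move=> x y z cx xy yz zd; apply: H2 => //; lra.
move=> x z ax xc cz zd.
case: (leP b x) => bx; first exact: H2.
apply: (@cvx3_right _ _ b) => //; first exact: H1.
exact: H2.
Qed.

End Convexity.

(** * The staircase and its length metric *)

(** The logarithm is one choice of slow growth; the outer successor makes every column contain a
    square. *)
Definition ht (n : nat) : nat := (trunc_log 2 n.+1).+1.

Lemma ht_gt0 n : (0 < ht n)%N. Proof. by []. Qed.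

Lemma leq_ht m n : (m <= n)%N -> (ht m <= ht n)%N.
Proof. by move=> mn; rewrite ltnS; apply: leq_trunc_log. Qed.

Lemma ht_unbounded k : exists n, (k <= ht n)%N.
Proof.
exists (2 ^ k).-1; rewrite /ht prednK ?expn_gt0 // trunc_expnK //.
Qed.

Lemma ht_sublinear n : (ht n ^ 2 <= 4 * n.+1)%N.
Proof.
rewrite /ht; have := @trunc_logP 2 n.+1 isT isT.
set k := trunc_log _ _ => H.
have {H} : (4 * 2 ^ k <= 4 * n.+1)%N by lia.
apply: leq_trans; elim: k => [//|k IH].
(* The step doubles the power, and [(k + 2) ^ 2 <= 2 * (k + 1) ^ 2] holds only from [k = 2] on. *)
have [k0|k0] := posnP k; first by rewrite k0.
have [k1|k1] := leqP k 1; first by have -> : k = 1%N by lia.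
rewrite [(2 ^ k.+1)%N]expnS; move: IH; set e := (2 ^ k)%N; rewrite -!mulnn => IH.
have : (k.+2 * k.+2 <= 2 * (k.+1 * k.+1))%N by nia.
lia.
Qed.

Definition region (R : realType) (z : R * R) : bool :=
  [&& 0 <= z.1, 0 <= z.2 & z.2 <= (ht (Num.truncn z.1))%:R].

Record stair (R : realType) := Stair { pt :> R * R ; ptP : region pt }.

HB.instance Definition _ (R : realType) := [isSub of stair R for @pt R].
HB.instance Definition _ (R : realType) := [Choice of stair R by <:].

(* The cell [n, n + wide] x [k, k + tall].  The condition on its column suffices
   also for the cells on the line x = n, since ht is nondecreasing. *)
Record grid_cell := GridCell {
  col_of : nat; row_of : nat; is_wide : bool; is_tall : bool;
  grid_cellP : (row_of + is_tall <= ht col_of)%N }.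

Definition cell_dim (c : grid_cell) : nat := (is_wide c + is_tall c)%N.

Section Staircase.
Variable R : realType.
Implicit Types (p q z : stair R) (c : grid_cell) (n : nat).

Lemma pt_inj p q : (p : R * R) = q -> p = q.
Proof. exact: val_inj. Qed.

Lemma pt1_ge0 p : 0 <= p.1.
Proof. by have /and3P[] := ptP p. Qed.

Lemma pt2_ge0 p : 0 <= p.2.
Proof. by have /and3P[] := ptP p. Qed.

Lemma regionP n (x y : R) : n%:R <= x <= n.+1%:R -> 0 <= y <= (ht n)%:R ->
  region (x, y).
Proof.
move=> /andP[nx xn] /andP[y0 yn]; rewrite /region /= y0.
have x0 : 0 <= x := le_trans (ler0n _ _) nx.
rewrite x0 /=; apply: (le_trans yn); rewrite ler_nat; apply: leq_ht.
by rewrite truncn_ge_nat.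
Qed.

(* The staircase is the union of the columns [n, n+1] x [0, ht n]; the column n
   meets the rest of the part on its right in the line {n+1} x [0, ht n]. *)
Definition inL n p := (p.1 <= n.+1%:R) && (p.2 <= (ht n)%:R).
Definition inR n p := n.+1%:R <= p.1.
Definition incol n p := (n%:R <= p.1) && inL n p.
Definition inline n p := inL n p && inR n p.

Lemma lt_inL n p : p.1 < n.+1%:R -> inL n p.
Proof.
move=> H; rewrite /inL ltW //=.
have /and3P[p0 _] := ptP p => /le_trans; apply; rewrite ler_nat; apply: leq_ht.
by rewrite -ltnS truncn_lt_nat.
Qed.

Lemma inLR n p : inL n p \/ inR n p.
Proof. by case: (ltP p.1 n.+1%:R) => H; [left; apply: lt_inL|right]. Qed.

Lemma inL_mono m n p : (m <= n)%N -> inL m p -> inL n p.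
Proof.
move=> mn /andP[H1 H2]; apply/andP; split.
  by apply: le_trans H1 _; rewrite ler_nat.
by apply: le_trans H2 _; rewrite ler_nat leq_ht.
Qed.

Lemma incol_inL n p : incol n p -> inL n p.
Proof. by case/andP. Qed.

Lemma incolS n p : incol n.+1 p = inL n.+1 p && inR n p.
Proof. by rewrite /incol andbC. Qed.

Lemma incol0 p : incol 0 p = inL 0 p.
Proof. by rewrite /incol pt1_ge0. Qed.

Lemma incol_truncn p : incol (Num.truncn p.1) p.
Proof.
have /and3P[p0 _ H] := ptP p; rewrite /incol /inL H andbT.
by have /andP[-> /ltW ->] := truncn_itv p0.
Qed.

Lemma inline_incol n p : inline n p -> incol n p.
Proof.
move=> /andP[H1 H2]; rewrite /incol H1 andbT.
by apply: le_trans H2; rewrite ler_nat.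
Qed.

Lemma inline_incolS n p : inline n p -> incol n.+1 p.
Proof.
by move=> /andP[H1 H2]; rewrite incolS H2 andbT; apply: inL_mono H1.
Qed.

Lemma inline1 n p : inline n p -> p.1 = n.+1%:R.
Proof. by move=> /andP[/andP[H1 _] H2]; apply/eqP; rewrite eq_le H1. Qed.

Lemma incol_exists n (x y : R) : n%:R <= x <= n.+1%:R -> 0 <= y <= (ht n)%:R ->
  exists2 p : stair R, (p : R * R) = (x, y) & incol n p.
Proof.
move=> Hx Hy; exists (Stair (regionP Hx Hy)) => //.
by rewrite /incol /inL /=; case/andP: Hx => -> ->; case/andP: Hy.
Qed.

Lemma inline_exists n (y : R) : 0 <= y <= (ht n)%:R ->
  exists2 p : stair R, (p : R * R) = (n.+1%:R, y) & inline n p.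
Proof.
move=> Hy; have [|p E H] := @incol_exists n n.+1%:R y _ Hy.
  by rewrite ler_nat leqnSn lexx.
by exists p => //; rewrite /inline (incol_inL H) /inR E /=.
Qed.

Lemma region_right p (x : R) : p.1 <= x -> region (x, p.2).
Proof.
move=> H; have /and3P[p0 p1 p2] := ptP p; apply/and3P; split => //=.
  exact: le_trans H.
apply: le_trans p2 _; rewrite ler_nat; apply: leq_ht; exact: le_truncn.
Qed.

Lemma region_down p (y : R) : 0 <= y <= p.2 -> region (p.1, y).
Proof.
move=> /andP[y0 H]; have /and3P[p0 p1 p2] := ptP p; apply/and3P; split => //=.
exact: le_trans p2.
Qed.

Lemma region00 : region (0 : R, 0 : R).
Proof. by apply: (@regionP 0); rewrite ?ler0n ?lexx. Qed.

Definition origin : stair R := Stair region00.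

(** [lsubmx u] and [rsubmx u] have at most one entry, so each sum is a coordinate, or 0 on a
    degenerate side; vertices, edges and squares are thus treated alike. *)
Definition cell_chart c (u : 'rV[R]_(cell_dim c)) : stair R :=
  insubd origin ((col_of c)%:R + \sum_i lsubmx u ord0 i,
                 (row_of c)%:R + \sum_i rsubmx u ord0 i).

Definition incell c p : Prop :=
  (col_of c)%:R <= p.1 <= (col_of c + is_wide c)%:R /\
  (row_of c)%:R <= p.2 <= (row_of c + is_tall c)%:R.

Lemma sum_ord_bool (b : bool) (F : 'I_b -> R) :
  (forall i, 0 <= F i <= 1) -> 0 <= \sum_i F i <= b%:R.
Proof. by case: b F => F; rewrite ?big_ord1 ?big_ord0 // lexx. Qed.

Lemma sumsqr_ord_bool (b : bool) (F : 'I_b -> R) :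
  \sum_i F i ^+ 2 = (\sum_i F i) ^+ 2.
Proof. by case: b F => F; rewrite ?big_ord1 ?big_ord0 // expr0n. Qed.

Lemma cell_chartE c (u : 'rV[R]_(cell_dim c)) : unit_cube u ->
  (cell_chart u : R * R) = ((col_of c)%:R + \sum_i lsubmx u ord0 i,
                 (row_of c)%:R + \sum_i rsubmx u ord0 i).
Proof.
move=> U; rewrite /cell_chart insubdK //.
have /andP[x0 x1] : 0 <= \sum_i lsubmx u ord0 i <= (is_wide c)%:R.
  by apply: sum_ord_bool => i; rewrite mxE; apply: U.
have /andP[y0 y1] : 0 <= \sum_i rsubmx u ord0 i <= (is_tall c)%:R.
  by apply: sum_ord_bool => i; rewrite mxE; apply: U.
apply: (@regionP (col_of c)).
  rewrite lerDl x0 /= -[in leRHS]addn1 natrD lerD2l.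
  by apply: le_trans x1 _; case: (is_wide c).
rewrite addr_ge0 //=.
have := grid_cellP c; rewrite -(ler_nat R) natrD; apply: le_trans.
by rewrite lerD2l.
Qed.

Lemma incell_chart c (u : 'rV[R]_(cell_dim c)) : unit_cube u ->
  incell c (cell_chart u).
Proof.
move=> U; rewrite /incell cell_chartE //= !lerDl !natrD !lerD2l.
by split; apply: sum_ord_bool => i; rewrite mxE; apply: U.
Qed.

Definition cell_coord c p : 'rV[R]_(cell_dim c) :=
  row_mx (const_mx (p.1 - (col_of c)%:R))
         (const_mx (p.2 - (row_of c)%:R)).

Lemma sum_const_bool (b : bool) (r : R) : 0 <= r <= b%:R -> \sum_(i < b) r = r.
Proof.
case: b => /=; rewrite ?big_ord1 ?big_ord0 // => H.
by apply/eqP; rewrite eq_sym eq_le andbC.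
Qed.

Lemma cell_coord_unit c p : incell c p -> unit_cube (cell_coord c p).
Proof.
move=> [/andP[H1 H2] /andP[H3 H4]] i; rewrite /cell_coord mxE.
case: (fintype.split i) => j; rewrite mxE subr_ge0 ?H1 ?H3 /=.
- have : (is_wide c) by case: (is_wide c) j => // -[].
  by move: H2; rewrite natrD => H E; rewrite E /= in H; lra.
- have : (is_tall c) by case: (is_tall c) j => // -[].
  by move: H4; rewrite natrD => H E; rewrite E /= in H; lra.
Qed.

Lemma cell_coordK c p : incell c p -> cell_chart (cell_coord c p) = p.
Proof.
move=> H; apply: pt_inj; rewrite cell_chartE; last exact: cell_coord_unit.
rewrite /cell_coord row_mxKl row_mxKr.
under eq_bigr do rewrite mxE.
under [X in (_, _ + X)]eq_bigr do rewrite mxE.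
case: H => [/andP[H1 H2] /andP[H3 H4]].
rewrite !natrD in H2 H4.
rewrite !sum_const_bool ?subrKC; last 2 first.
- by apply/andP; split; lra.
- by apply/andP; split; lra.
by case: (pt p).
Qed.

Lemma eucl_dist_chart c (u v : 'rV[R]_(cell_dim c)) :
  unit_cube u -> unit_cube v ->
  eucl_dist u v = ed (cell_chart u) (cell_chart v).
Proof.
move=> Hu Hv; rewrite /eucl_dist /ed /sqd !cell_chartE //=; congr Num.sqrt.
rewrite big_split_ord /= !sumsqr_ord_bool.
rewrite !opprD ![_ + _ + (- _ + _)]addrACA !subrr !add0r -!sumrB.
by congr (_ ^+ 2 + _ ^+ 2); apply: eq_bigr => i _; rewrite !mxE.
Qed.

(** * Strings and the length metric *)

Notation str := (string (@cell_chart)).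

Lemma string_step c p q z l : incell c p -> incell c q -> str q z l ->
  str p z (ed p q + l).
Proof.
move=> Hp Hq S; have Up := cell_coord_unit Hp; have Uq := cell_coord_unit Hq.
have := @string_cons R _ _ _ (@cell_chart) c _ _ z l Up Uq.
by rewrite eucl_dist_chart // !cell_coordK //; apply.
Qed.

Lemma string_ind_cell (P : stair R -> stair R -> R -> Prop) :
  (forall p, P p p 0) ->
  (forall c p q z l, incell c p -> incell c q -> str q z l -> P q z l ->
    P p z (ed p q + l)) ->
  forall p q l, str p q l -> P p q l.
Proof.
move=> H0 H1 p q l; elim=> [//|c u v z l' Uu Uv S IH].
rewrite eucl_dist_chart //; apply: (H1 c) => //; exact: incell_chart.
Qed.

Lemma string_one c p q : incell c p -> incell c q -> str p q (ed p q).
Proof.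
by move=> Hp Hq; rewrite -[ed p q]addr0; apply: string_step Hp Hq (string_nil _ _).
Qed.

Lemma string_cat p q z l l' : str p q l -> str q z l' -> str p z (l + l').
Proof.
move=> S; elim/string_ind_cell: p q l / S z l' => [p|c p q z l Hp Hq _ IH] z' l' S.
  by rewrite add0r.
by rewrite -addrA; apply: (string_step Hp Hq); apply: IH.
Qed.

Lemma string_sym p q l : str p q l -> str q p l.
Proof.
elim/string_ind_cell => {p q l} [p|c p q z l Hp Hq _ IH]; first exact: string_nil.
by rewrite addrC; apply: string_cat IH _; rewrite edC; apply: string_one Hq Hp.
Qed.

Lemma string_ge_ed p q l : str p q l -> ed p q <= l.
Proof.
elim/string_ind_cell => {p q l} [p|c p q z l Hp Hq _ IH]; first by rewrite edxx.
by apply: le_trans (ed_triangle _ _ q) _; rewrite lerD2l.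
Qed.

Lemma incell_side c n p q : incell c p -> incell c q ->
  (inL n p /\ inL n q) \/ (inR n p /\ inR n q).
Proof.
move=> [/andP[H1 H2] /andP[H3 H4]] [/andP[H5 H6] /andP[H7 H8]].
case: (leqP (col_of c) n) => Hn; last first.
  by right; split; [apply: le_trans H1|apply: le_trans H5]; rewrite ler_nat.
have X : (col_of c + is_wide c)%:R <= n.+1%:R :> R.
  by rewrite ler_nat; case: (is_wide c); rewrite ?addn1 ?addn0 // ltnW // ltnS.
have Y : (row_of c + is_tall c)%:R <= (ht n)%:R :> R.
  by rewrite ler_nat; apply: leq_trans (grid_cellP c) (leq_ht Hn).
by left; rewrite /inL !(le_trans H2, le_trans H4, le_trans H6, le_trans H8).
Qed.

(** As no cell straddles the line, some point of the string itself lies on it, and the string can be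
    cut there. *)
Lemma string_crossing n p q l : str p q l -> inL n p -> inR n q ->
  exists z l1 l2, [/\ inline n z, str p z l1, str z q l2 & l = l1 + l2].
Proof.
elim/string_ind_cell => {p q l} [p|c p q z l Hp Hq S IH] pL zR.
  exists p, 0, 0; rewrite addr0 /inline pL zR; split => //; exact: string_nil.
have [[_ qL]|[pR _]] := incell_side n Hp Hq.
  have [z' [l1 [l2 [H1 H2 H3 ->]]]] := IH qL zR.
  exists z', (ed p q + l1), l2; split; rewrite ?addrA //.
  exact: string_step Hp Hq H2.
exists p, 0, (ed p q + l); split; rewrite ?add0r //.
- by rewrite /inline pL pR.
- exact: string_nil.
- exact: string_step Hp Hq S.
Qed.

Lemma ht_box n k : (k < ht n)%N -> (k + true <= ht n)%N.
Proof. by rewrite addn1. Qed.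

Definition box n k (H : (k < ht n)%N) := @GridCell n k true true (ht_box H).

Lemma incell_box n k (H : (k < ht n)%N) p : incol n p ->
  k%:R <= p.2 <= k.+1%:R -> incell (box H) p.
Proof. by move=> /and3P[H1 H2 _] ?; rewrite /incell /= !addn1 H1 H2. Qed.

(** The straight segment is cut at the integral heights. The induction is on the row of the upper
    end and peels off the topmost piece. *)
Lemma incol_string n p q : incol n p -> incol n q -> str p q (ed p q).
Proof.
move=> Hp Hq.
wlog pq : p q Hp Hq / p.2 <= q.2.
  move=> W; case: (leP p.2 q.2) => H; first exact: W.
  by rewrite edC; apply: string_sym; apply: W => //; apply: ltW.
have : exists2 k, (k < ht n)%N & q.2 <= k.+1%:R.
  by exists (ht n).-1; rewrite ?ltn_predL // prednK //; case/and3P: Hq.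
case=> k kn qk; elim: k q Hq pq kn qk => [|k IH] q Hq pq kn qk.
  by apply: (@string_one (box kn)); apply: incell_box => //;
    rewrite pt2_ge0 //=; apply: le_trans qk.
case: (leP q.2 k.+1%:R) => qk1; first by apply: IH => //; apply: ltnW.
case: (leP k.+1%:R p.2) => pk.
  apply: (@string_one (box kn)); apply: incell_box => //; apply/andP; split => //.
    exact: le_trans qk.
  exact: ltW.
set y : R := k.+1%:R in pk qk1.
(* The parameter at which the segment meets the height [y]. *)
pose t := (y - p.2) / (q.2 - p.2).
have D0 : 0 < q.2 - p.2 by lra.
have t0 : 0 <= t by rewrite divr_ge0 //; lra.
have t1 : t <= 1 by rewrite ler_pdivrMr // mul1r; lra.
have ty : t * (q.2 - p.2) = y - p.2.
  by rewrite divfK // gt_eqF.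
have /and3P[p1 p2 p3] := Hp; have /and3P[q1 q2 q3] := Hq.
pose x := (1 - t) * p.1 + t * q.1.
have [||z zE zc] := @incol_exists n x y.
- by apply/andP; split; rewrite /x; nra.
- by rewrite ler0n /= ler_nat ltnW.
have -> : ed p q = ed p z + ed z q.
  have N : 0 <= ed p q by exact: ed_ge0.
  have S := sqr_ed p q.
  have Q : q.2 = p.2 + (q.2 - p.2) by lra.
  have yE : y = p.2 + t * (q.2 - p.2) by lra.
  rewrite [ed p z](@ed_eq _ _ _ (t * ed p q)); last 2 first.
  - exact: mulr_ge0.
  - by rewrite exprMn S /sqd zE /= yE /x; ring.
  rewrite [ed z q](@ed_eq _ _ _ ((1 - t) * ed p q)); first by lra.
    by rewrite mulr_ge0 // subr_ge0.
  by rewrite exprMn S /sqd zE /= yE /x; ring.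
apply: string_cat.
  by apply: IH => //; [rewrite zE /= ltW|exact: ltnW|rewrite zE].
apply: (@string_one (box kn)); apply: incell_box => //.
  by rewrite zE /= lexx ler_nat leqnSn.
by rewrite qk andbT ltW.
Qed.

(** Moving right never leaves the staircase, as [ht] is nondecreasing; the induction counts the
    columns still to be crossed. *)
Lemma horizontal_string p q : p.1 <= q.1 ->
  p.2 = q.2 -> str p q (q.1 - p.1).
Proof.
have [m] := ubnP (Num.truncn q.1 - Num.truncn p.1)%N.
elim: m p => // m IH p Hm pq1 pq2.
set n := Num.truncn p.1 in Hm.
have Hp : incol n p := incol_truncn p.
case: (leP q.1 n.+1%:R) => qn.
  have Hq : incol n q.
    apply/and3P; split => //; first by apply: le_trans pq1; case/and3P: Hp.
    by rewrite -pq2; case/and3P: Hp.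
  have := incol_string Hp Hq.
  by rewrite ed_horizontal // distrC ger0_norm // subr_ge0.
have /and3P[p1 p2 p3] := Hp.
have [|z zE zc] := @inline_exists n p.2; first by rewrite pt2_ge0.
have -> : q.1 - p.1 =
    (n.+1%:R - p.1) + (q.1 - n.+1%:R) by lra.
apply: (@string_cat _ z).
  have := incol_string Hp (inline_incol zc).
  by rewrite ed_horizontal ?zE //= distrC ger0_norm // subr_ge0.
have z1 : z.1 = n.+1%:R by rewrite zE.
rewrite -z1; apply: IH; rewrite ?zE /=; last 2 first.
- exact: ltW.
- by rewrite pq2.
rewrite natrK; move: Hm; rewrite ltnS.
have : (n.+1 <= Num.truncn q.1)%N by rewrite truncn_ge_nat ?pt1_ge0 // ltW.
lia.
Qed.

Lemma vertical_string p q : p.1 = q.1 ->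
  str p q `|p.2 - q.2|.
Proof.
move=> E; rewrite -ed_vertical //; apply: (@incol_string (Num.truncn p.1)).
  exact: incol_truncn.
by rewrite E; apply: incol_truncn.
Qed.

(** Going right before going up or down keeps the corner in the region. This also shows that the
    infimum defining the metric is over a nonempty set. *)
Lemma manhattan_string p q :
  str p q (`|p.1 - q.1| + `|p.2 - q.2|).
Proof.
wlog pq : p q / p.1 <= q.1.
  move=> W; case: (leP p.1 q.1) => H; first exact: W.
  by rewrite distrC [`|_.2 - _|]distrC; apply: string_sym; apply: W; apply: ltW.
pose z := Stair (region_right pq); apply: (@string_cat _ z).
  by rewrite distrC ger0_norm ?subr_ge0 //; apply: (@horizontal_string _ z).
exact: (@vertical_string z).
Qed.

Definition sd p q : R := inf [set l | str p q l].

Lemma str_has_inf p q : has_inf [set l | str p q l].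
Proof.
split; first by eexists; apply: manhattan_string.
by exists 0 => l /string_ge_ed; apply: le_trans; exact: ed_ge0.
Qed.

Lemma sd_le_string p q l : str p q l -> sd p q <= l.
Proof. by move=> S; apply: ge_inf => //; have [] := str_has_inf p q. Qed.

Lemma le_sd p q l : (forall l', str p q l' -> l <= l') -> l <= sd p q.
Proof. by move=> H; apply: lb_le_inf => //; have [] := str_has_inf p q. Qed.

Lemma ed_le_sd p q : ed p q <= sd p q.
Proof. by apply: le_sd => l; apply: string_ge_ed. Qed.

Lemma sd_ge0 p q : 0 <= sd p q.
Proof. exact: le_trans (ed_ge0 _ _) (ed_le_sd _ _). Qed.

Lemma sdxx p : sd p p = 0.
Proof. by apply/eqP; rewrite eq_le sd_ge0 andbT sd_le_string //; apply: string_nil. Qed.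

Lemma sd_eq0 p q : sd p q = 0 -> p = q.
Proof.
move=> E; apply: pt_inj; apply: ed_eq0; apply/eqP; rewrite eq_le ed_ge0 andbT.
by rewrite -E ed_le_sd.
Qed.

Lemma sdC p q : sd p q = sd q p.
Proof.
by apply/eqP; rewrite eq_le; apply/andP; split; apply: le_sd => l /string_sym;
  apply: sd_le_string.
Qed.

Lemma sd_triangle z p q : sd p q <= sd p z + sd z q.
Proof.
rewrite -lerBlDr; apply: le_sd => l1 S1; rewrite lerBlDl -lerBlDr.
by apply: le_sd => l2 S2; rewrite lerBlDl; apply: sd_le_string; apply: string_cat S2.
Qed.

HB.instance Definition _ :=
  isMetric.Build R (stair R) sdxx sd_eq0 sdC sd_triangle.

End Staircase.

(** * Stewart's inequality in a column *)

Section Sources.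
Variable R : realType.
Implicit Types (p q z a c m : stair R) (v w : R * R) (n : nat).

Lemma sd_incol n p q : incol n p -> incol n q -> sd p q = ed p q.
Proof.
move=> Hp Hq; apply/eqP; rewrite eq_le ed_le_sd andbT.
exact: sd_le_string (incol_string Hp Hq).
Qed.

Lemma inline_sd n p q : inline n p -> inline n q -> sd p q = `|p.2 - q.2|.
Proof.
move=> Hp Hq; rewrite (sd_incol (inline_incol Hp) (inline_incol Hq)).
by rewrite ed_vertical // !(inline1 Hp, inline1 Hq).
Qed.

Lemma lipschitz_continuous (f : R -> R) (k : R) : 0 < k ->
  (forall x y, `|f x - f y| <= k * `|x - y|) -> continuous f.
Proof.
move=> k0 H x; apply/cvgrPdist_le => e e0; near=> y.
apply: le_trans (H _ _) _; rewrite mulrC -ler_pdivlMr //.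
near: y; apply: cvgr_dist_le => //; exact: divr_gt0.
Unshelve. all: by end_near.
Qed.

(** By compactness of the line, [sd p c + sd c q] attains its minimum there, and no string does
    better since each has a point on the line. [clamp] makes the height parameter total, for the
    extreme value theorem. *)
Lemma crossing n p q : inL n p -> inR n q ->
  exists2 c, inline n c & sd p q = sd p c + sd c q.
Proof.
move=> Hp Hq; pose b : R := (ht n)%:R.
have b0 : 0 <= b by rewrite ler0n.
pose clp := clamp 0 b.
have clpP h : 0 <= clp h <= b := clampP h b0.
pose c h := insubd (origin R) (n.+1%:R : R, clp h).
have cE h : (c h : R * R) = (n.+1%:R, clp h).
  rewrite /c insubdK //; apply: (@regionP _ n) => //.
  by rewrite ler_nat leqnSn lexx.
have cL h : inline n (c h).
  have /andP[_ Hh] := clpP h.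
  by rewrite /inline /inL /inR cE /= !lexx /= andbT.
pose G h := sd p (c h) + sd (c h) q.
have cc h h' : sd (c h) (c h') <= `|h - h'|.
  by rewrite (inline_sd (cL h) (cL h')) !cE /=; apply: clamp_lipschitz.
have Gc : continuous G.
  apply: (@lipschitz_continuous _ 2) => // h h'; rewrite ler_norml /G.
  have := cc h h'; have := cc h' h; rewrite distrC => H1 H2.
  have := sd_triangle (c h) p (c h'); have := sd_triangle (c h') p (c h).
  have := sd_triangle (c h) (c h') q; have := sd_triangle (c h') (c h) q.
  by lra.
have [h hb Hmin] := EVT_min b0 (continuous_subspaceT Gc).
exists (c h) => //; apply/eqP; rewrite eq_le sd_triangle /=.
apply: le_sd => l /string_crossing/(_ Hp Hq) [z [l1 [l2 [Hz S1 S2 ->]]]].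
have z2 : 0 <= z.2 <= b by rewrite pt2_ge0; case/andP: Hz => /andP[].
have Ez : c z.2 = z.
  by apply: pt_inj; rewrite cE /clp clamp_id // -(inline1 Hz); case: (pt z).
have := Hmin z.2; rewrite in_itv /= z2 => /(_ isT); rewrite /G Ez.
have := sd_le_string S1; have := sd_le_string S2; lra.
Qed.

(** A support of [sd p] at [m]; the point [v] of the plane may lie outside the staircase. *)
Definition source p (A : stair R -> bool) m v :=
  sqd m v = sd p m ^+ 2 /\ forall x, A x -> sqd x v <= sd p x ^+ 2.

Lemma source_self n p m : incol n p -> incol n m -> source p (incol n) m p.
Proof.
move=> Hp Hm; split; first by rewrite (sd_incol Hp Hm) sqr_ed sqdC.
by move=> x Hx; rewrite (sd_incol Hp Hx) sqr_ed sqdC.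
Qed.

Lemma source_sub (A B : stair R -> bool) p m v :
  (forall x, A x -> B x) -> source p B m v -> source p A m v.
Proof. by move=> AB [H1 H2]; split => // x /AB /H2. Qed.

(** From [c] to [x] the distance to [v] grows by at most [ed c x], the distance to [p] by
    [sd c x]. *)
Lemma extend_source p v c x : sqd c v <= sd p c ^+ 2 ->
  sd p x = sd p c + sd c x -> sqd x v <= sd p x ^+ 2.
Proof.
move=> H E; rewrite -!sqr_ed ler_sqr ?nnegrE ?ed_ge0 ?sd_ge0 //.
apply: le_trans (ed_triangle _ _ c) _; rewrite E addrC lerD //.
  by apply: ed_le => //; apply: sd_ge0.
by rewrite edC ed_le_sd.
Qed.

(* The first-order condition at the crossing point c0 says that the direction
   from c0 to x0 is a subgradient of sd p along the line; strong convexity of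
   sd p ^+ 2 on the line turns it into a global bound. *)
Lemma line_source n p x c0 : inline n c0 ->
  (forall c, inline n c -> exists w, source p (inline n) c w) -> x <> c0 ->
  sd p x = sd p c0 + ed c0 x ->
  (forall c, inline n c -> sd p x <= sd p c + ed c x) ->
  exists v, [/\ sqd x v = sd p x ^+ 2,
    (forall c, inline n c -> sqd c v <= sd p c ^+ 2) &
    exists2 k, 0 <= k & x.1 - v.1 = k * (x.1 - c0.1)].
Proof.
move=> Hc0 Hsrc xc0 E Hmin.
set B := ed c0 x in E; have B0 : 0 < B by apply: ed_gt0 => /pt_inj /esym.
have Bn : B != 0 by rewrite gt_eqF.
set D := sd p c0; have D0 : 0 <= D by exact: sd_ge0.
pose u1 := (x.1 - c0.1) / B; pose u2 := (x.2 - c0.2) / B.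
have e1 : x.1 - c0.1 = B * u1 by rewrite mulrC divfK.
have e2 : x.2 - c0.2 = B * u2 by rewrite mulrC divfK.
have U : u1 ^+ 2 + u2 ^+ 2 = 1.
  apply: (@mulfI _ (B ^+ 2)); first by rewrite expf_neq0.
  rewrite mulr1 mulrDr -!exprMn -e1 -e2 sqr_ed /sqd; ring.
(* The source lies behind [c0] as seen from [x], at distance [D] from [c0]. *)
exists (c0.1 - D * u1, c0.2 - D * u2); split; last first.
- exists (1 + D / B); first by rewrite addr_ge0 // divr_ge0 // ltW.
  rewrite /= (_ : x.1 = c0.1 + B * u1); last by rewrite -e1; ring.
  by field.
- move=> c Hc; set e := c.2 - c0.2.
  have -> : sqd c (c0.1 - D * u1, c0.2 - D * u2) =
      D ^+ 2 * (u1 ^+ 2 + u2 ^+ 2) + 2 * D * e * u2 + e ^+ 2.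
    by rewrite /sqd /= (inline1 Hc) (inline1 Hc0) /e; ring.
  rewrite U mulr1.
  (* Let [z] be the point at fraction [t] from [c0] to [c]. Minimality of [c0] bounds [sd p z]
     below, and a source at [z] bounds [sd p z ^+ 2] above by Stewart's combination of the values at
     [c0] and [c]. Dividing by [t] and letting it tend to 0 gives the bound at [c]. *)
  apply: (@le_of_small_error _ _ _ (D * e ^+ 2 / B + e ^+ 2)).
  move=> t /andP[t0 t1].
  have [|z zE Hz] := @inline_exists R n (c0.2 + t * e).
    have /andP[/andP[_ q1] _] := Hc0; have /andP[/andP[_ q2] _] := Hc.
    have q3 := pt2_ge0 c0; have q4 := pt2_ge0 c; rewrite /e.
    by apply/andP; split; nra.
  have [w [W1 W2]] := Hsrc z Hz.
  have S : (1 - t) * sqd c0 w + t * sqd c w = sqd z w + t * (1 - t) * e ^+ 2.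
    by rewrite /sqd zE /= (inline1 Hc) (inline1 Hc0) /e; ring.
  have := W2 c0 Hc0; have := W2 c Hc; rewrite -/D => Wc Wc0.
  have M : ed z x <= B - t * (u2 * e) + t ^+ 2 * (e ^+ 2 / (2 * B)).
    have := @ed_move_le _ c0 x 0 e t; rewrite -/B => /(_ _).
    have -> : ((c0 : R * R).1 + t * 0, c0.2 + t * e) = (z : R * R).
      by rewrite zE mulr0 addr0 (inline1 Hc0).
    move=> /(_ (fun h => xc0 (esym (pt_inj h)))).
    rewrite -(opprB x.1) -(opprB x.2) e1 e2.
    congr (_ <= _); field; exact: Bn.
  have Mz := Hmin z Hz; rewrite E -/D in Mz.
  have P : sd p z ^+ 2 >= D ^+ 2 + 2 * D * (sd p z - D).
    have := sqr_ge0 (sd p z - D); lra.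
  have Q : D * (t * (u2 * e) - t ^+ 2 * (e ^+ 2 / (2 * B))) <= D * (sd p z - D).
    by apply: ler_wpM2l => //; lra.
  rewrite -(ler_pM2l t0).
  have t1' : 0 <= 1 - t by lra.
  have := ler_wpM2l t1' Wc0; have := ler_wpM2l (ltW t0) Wc.
  have -> : D * e ^+ 2 / B = 2 * D * (e ^+ 2 / (2 * B)) by field.
  by rewrite W1 in S; lra.
- rewrite E /sqd /= (_ : x.1 = c0.1 + B * u1); last by rewrite -e1; ring.
  rewrite (_ : x.2 = c0.2 + B * u2); last by rewrite -e2; ring.
  transitivity ((B + D) ^+ 2 * (u1 ^+ 2 + u2 ^+ 2)); first by ring.
  by rewrite U mulr1 addrC.
Qed.

(** The source for [m] is placed in the direction of the point [c] where a shortest path crosses the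
    line; if [m] is [c], the source on the line is reused. The side on which it lies is recorded for
    [turn_sources]. *)
Lemma right_sources n p : inL n p ->
  (forall c, inline n c -> exists2 v, source p (inline n) c v & v.1 <= n.+1%:R) ->
  forall m, incol n.+1 m -> exists2 v, source p (incol n.+1) m v & v.1 <= m.1.
Proof.
move=> Hp Hsrc m Hm.
have HR (x : stair R) : incol n.+1 x -> inR n x by rewrite incolS => /andP[].
have ext v : (forall c, inline n c -> sqd c v <= sd p c ^+ 2) ->
    forall x, incol n.+1 x -> sqd x v <= sd p x ^+ 2.
  move=> H x /HR Hx; have [c Hc E] := crossing Hp Hx.
  exact: extend_source (H c Hc) E.
have [c Hc E] := crossing Hp (HR m Hm).
have [Em|Nm] := pselect (m = c).
  have [v [v1 v2] v3] := Hsrc c Hc.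
  exists v; last by rewrite Em (inline1 Hc).
  by rewrite Em; split => //; apply: ext.
have cm x : inline n x -> sd x m = ed x m.
  by move=> Hx; apply: sd_incol (inline_incolS Hx) Hm.
have [||||v [v1 v2 [k k0 v3]]] := @line_source n p m c Hc.
- by move=> x /Hsrc[v ? _]; exists v.
- exact: Nm.
- by rewrite -cm.
- by move=> x Hx; rewrite -cm //; apply: sd_triangle.
exists v; first by split => //; apply: ext.
rewrite -subr_ge0 v3 mulr_ge0 // subr_ge0 (inline1 Hc); exact: HR.
Qed.

Lemma left_sources n p : inR n p ->
  (forall c, inline n c -> exists2 v, source p (inline n) c v & n.+1%:R <= v.1) ->
  forall m, incol n m -> exists2 v, source p (incol n) m v & m.1 <= v.1.
Proof.
move=> Hp Hsrc m Hm.
have HL (x : stair R) : incol n x -> inL n x by case/andP.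
have ext v : (forall c, inline n c -> sqd c v <= sd p c ^+ 2) ->
    forall x, incol n x -> sqd x v <= sd p x ^+ 2.
  move=> H x /HL Hx; have [c Hc E] := crossing Hx Hp.
  by apply: extend_source (H c Hc) _; rewrite (sdC p x) E (sdC x c) (sdC c p) addrC.
have [c Hc] := crossing (HL m Hm) Hp; rewrite sdC addrC (sdC c p) => E.
have [Em|Nm] := pselect (m = c).
  have [v [v1 v2] v3] := Hsrc c Hc.
  exists v; last by rewrite Em (inline1 Hc).
  by rewrite Em; split => //; apply: ext.
have cm x : inline n x -> sd x m = ed x m.
  by move=> Hx; apply: sd_incol (inline_incol Hx) Hm.
have [||||v [v1 v2 [k k0 v3]]] := @line_source n p m c Hc.
- by move=> x /Hsrc[v ? _]; exists v.
- exact: Nm.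
- by rewrite -cm // (sdC c).
- by move=> x Hx; rewrite -cm //; apply: sd_triangle.
exists v; first by split => //; apply: ext.
rewrite -subr_le0 v3 mulr_ge0_le0 // subr_le0 (inline1 Hc).
by case/andP: (HL _ Hm).
Qed.

Lemma line_source_right n p c : inL n p -> inline n c ->
  exists2 v, source p (incol n) c v & v.1 <= c.1.
Proof.
elim: n c => [|n IH] c Hp Hc.
  exists p; last by rewrite (inline1 Hc); case/andP: Hp.
  by apply: source_self; [rewrite incol0|apply: inline_incol].
have [Hp'|Hp'] := inLR n p.
  apply: (right_sources Hp') (inline_incol Hc) => c' Hc'.
  have [v v1 v2] := IH c' Hp' Hc'; rewrite -(inline1 Hc'); exists v => //.
  by apply: source_sub v1 => x; apply: inline_incol.
exists p; last by rewrite (inline1 Hc); case/andP: Hp.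
by apply: source_self; [rewrite incolS Hp|apply: inline_incol].
Qed.

Lemma line_source_left n p c : inR n p -> inline n c ->
  exists2 v, source p (incol n.+1) c v & c.1 <= v.1.
Proof.
have [k] := ubnP (Num.truncn p.1 - n)%N; elim: k n c => // k IH n c Hk Hp Hc.
have [Hp'|Hp'] := inLR n.+1 p.
  exists p; last by rewrite (inline1 Hc).
  by apply: source_self; [rewrite incolS Hp'|apply: inline_incolS].
apply: (left_sources Hp') (inline_incolS Hc) => c' Hc'.
rewrite -(inline1 Hc'); have [|v v1 v2] := IH n.+1 c' _ Hp' Hc'.
  have : (n.+2 <= Num.truncn p.1)%N by rewrite truncn_ge_nat ?pt1_ge0.
  by move: Hk; lia.
by exists v => //; apply: source_sub v1 => x; apply: inline_incolS.
Qed.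

Lemma incol_source n p m : incol n m -> exists v, source p (incol n) m v.
Proof.
move=> Hm; have [Hp|Hp] := inLR n p; last first.
  have [|v ? _] := left_sources Hp _ Hm; last by exists v.
  move=> c Hc; rewrite -(inline1 Hc).
  have [v v1 v2] := line_source_left Hp Hc; exists v => //.
  by apply: source_sub v1 => x; apply: inline_incolS.
case: n Hm Hp => [|n] Hm Hp; first by exists p; apply: source_self; rewrite // incol0.
have [Hp'|Hp'] := inLR n p; last first.
  by exists p; apply: source_self => //; rewrite incolS Hp.
have [|v ? _] := right_sources Hp' _ Hm; last by exists v.
move=> c Hc; rewrite -(inline1 Hc).
have [v v1 v2] := line_source_right Hp' Hc; exists v => //.
by apply: source_sub v1 => x; apply: inline_incol.
Qed.

(* An equality in the Euclidean plane when z lies between a and c. *)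
Definition stew p a z c :=
  (sd a z + sd z c) * sd p z ^+ 2 <=
  sd z c * sd p a ^+ 2 + sd a z * sd p c ^+ 2
  - sd a z * sd z c * (sd a z + sd z c).

Lemma stew_sym p a z c : stew p a z c -> stew p c z a.
Proof. by rewrite /stew (sdC z a) (sdC c z); lra. Qed.

(** [sd] is at least the Euclidean distance and equals it between [a] and [c], so equality for [sd]
    forces equality in the plane: a geodesic between points of a column stays on their segment. *)
Lemma incol_between n a z c : incol n a -> incol n c ->
  sd a z + sd z c = sd a c ->
  [/\ incol n z, (sd a z + sd z c) * z.1 = sd z c * a.1 + sd a z * c.1 &
      (sd a z + sd z c) * z.2 = sd z c * a.2 + sd a z * c.2].
Proof.
move=> Ha Hc E.
have H1 := ed_le_sd a z; have H2 := ed_le_sd z c; have H3 := ed_triangle a c z.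
have E3 := sd_incol Ha Hc.
have [E1 E2] : ed a z = sd a z /\ ed z c = sd z c by split; lra.
have [|G1 G2] := @segment_of_ed_eq _ a z c; first by lra.
rewrite E1 E2 in G1 G2; split => //.
have x0 := sd_ge0 a z; have y0 := sd_ge0 z c.
have [S|S] := eqVneq (sd a z + sd z c) 0.
  by rewrite -(@sd_eq0 _ a z) //; lra.
have P : 0 < sd a z + sd z c by rewrite lt_def S; lra.
have /and3P[a1 a2 a3] := Ha; have /and3P[c1 c2 c3] := Hc.
by apply/and3P; split; rewrite -(ler_pM2l P) ?G1 ?G2; nra.
Qed.

(** Stewart's identity for a source at [z]: its distance is exact at [z] and a lower bound at [a]
    and [c], which is the direction needed. *)
Lemma stew_incol n p a z c : incol n a -> incol n c ->
  sd a z + sd z c = sd a c -> stew p a z c.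
Proof.
move=> Ha Hc E; have [Hz E1 E2] := incol_between Ha Hc E.
have [v [v1 v2]] := incol_source p Hz.
have S := stewart_sqd v E1 E2.
have x0 := sd_ge0 a z; have y0 := sd_ge0 z c; rewrite /stew.
have [L0|L0] := eqVneq (sd a z + sd z c) 0.
  have [-> ->] : sd a z = 0 /\ sd z c = 0 by split; lra.
  by rewrite !(addr0, mul0r, subr0).
have P : 0 < sd a z + sd z c by rewrite lt_def L0; lra.
rewrite -(ler_pM2l P).
have A := v2 a Ha; have C := v2 c Hc.
have := ler_wpM2l y0 A; have := ler_wpM2l x0 C => C' A'.
have {A' C'} := ler_wpM2l (ltW P) (lerD A' C').
have Q : sqd a c = (sd a z + sd z c) ^+ 2 by rewrite E (sd_incol Ha Hc) sqr_ed.
rewrite v1 Q in S; lra.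
Qed.

End Sources.

(** * Turning points *)

Section Break.
Variable R : realType.
Implicit Types (p q z a c m : stair R) (v w : R * R) (n : nat).

(* Here w1 and w2 are the vertical components of the unit directions from m to a
   and to c: a geodesic crosses a line either straight, or turning upwards around
   the top of the line. *)
Lemma turn_up n a m c (w1 w2 : R) : inline n m -> incol n a -> incol n.+1 c ->
  a <> m -> m <> c -> sd a c = sd a m + sd m c ->
  w1 = (a.2 - m.2) / ed a m -> w2 = (c.2 - m.2) / ed m c ->
  0 <= w1 + w2 /\ (w1 + w2 = 0 \/ m.2 = (ht n)%:R).
Proof.
move=> Hm Ha Hc am mc E W1 W2.
have Am : sd a m = ed a m := sd_incol Ha (inline_incol Hm).
have Mc : sd m c = ed m c := sd_incol (inline_incolS Hm) Hc.
have x0 : 0 < ed a m by apply: ed_gt0 => /pt_inj.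
have y0 : 0 < ed m c by apply: ed_gt0 => /pt_inj.
have xn : ed a m != 0 by rewrite gt_eqF.
have yn : ed m c != 0 by rewrite gt_eqF.
have /andP[/andP[_ mt] _] := Hm; have m0 := pt2_ge0 m.
(* First variation: moving the crossing point vertically from [m] by [t * e] cannot shorten the
   path. *)
have var (e : R) : 0 <= m.2 + e <= (ht n)%:R -> e * (w1 + w2) <= 0.
  move=> /andP[e0 e1].
  apply: (@le_of_small_error _ _ _ (e ^+ 2 / (2 * ed a m) + e ^+ 2 / (2 * ed m c))).
  move=> t /andP[t0 t1].
  have [|z zE Hz] := @inline_exists R n (m.2 + t * e).
    by apply/andP; split; nra.
  have := sd_triangle z a c; rewrite E Am Mc (sd_incol Ha (inline_incol Hz)).
  rewrite (sd_incol (inline_incolS Hz) Hc) (edC a z).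
  have -> : (z : R * R) = (m.1 + t * 0, m.2 + t * e).
    by rewrite zE mulr0 addr0 (inline1 Hm).
  have := @ed_move_le _ m a 0 e t (fun h => am (esym (pt_inj h))).
  have := @ed_move_le _ m c 0 e t (fun h => mc (pt_inj h)).
  rewrite (edC m a).
  set A := ed (_, _) c; set B := ed (_, _) a.
  rewrite -(opprB a.2) -(opprB c.2) !mulr0 expr0n !add0r.
  have -> : t * (- (c.2 - m.2) * e) / ed m c = - (t * e * w2) by rewrite W2; ring.
  have -> : t * (- (a.2 - m.2) * e) / ed a m = - (t * e * w1) by rewrite W1; ring.
  rewrite -!(mulrA (t ^+ 2)) => H1 H2 H3.
  rewrite -(ler_pM2l t0); lra.
(* Moving down to the floor gives the sign; at the floor itself both components are nonnegative. *)
have w0 : 0 <= w1 + w2.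
  have [m0'|m0'] := eqVneq m.2 0.
    by rewrite W1 W2 m0' !subr0 addr_ge0 // divr_ge0 ?pt2_ge0 ?ed_ge0.
  have mp : 0 < m.2 by rewrite lt_def m0'.
  have := var (- m.2); rewrite subrr lexx ler0n mulNr oppr_le0 => /(_ isT).
  by rewrite pmulr_rge0.
(* Below the top, moving up is possible too and gives the opposite sign. *)
split => //; have [mt'|mt'] := eqVneq m.2 (ht n)%:R; [by right|left].
have mp : 0 < (ht n)%:R - m.2 by rewrite subr_gt0 lt_neqAle mt'.
have := var ((ht n)%:R - m.2); rewrite subrKC lexx ler0n => /(_ isT).
by rewrite pmulr_rle0 // => ?; apply/eqP; rewrite eq_le w0 andbT.
Qed.

(** If the path is straight, one source serves both columns. Otherwise [m] is the top of the line:
    lowering a source on its circle about [m] brings it nearer to the rest of the line, so it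
    remains a lower bound there and, by [crossing], beyond it. The source lowered is the one for the
    column on the far side from [p]. *)
Lemma turn_sources p n m (w1x w1y w2x w2y : R) : inline n m ->
  w1x ^+ 2 + w1y ^+ 2 = 1 -> w2x ^+ 2 + w2y ^+ 2 = 1 -> w1x <= 0 -> 0 <= w2x ->
  0 <= w1y + w2y -> w1y + w2y = 0 \/ m.2 = (ht n)%:R ->
  exists v1 v2, [/\ source p (incol n) m v1, source p (incol n.+1) m v2 &
    0 <= ((m.1 - v1.1) * w1x + (m.2 - v1.2) * w1y)
       + ((m.1 - v2.1) * w2x + (m.2 - v2.2) * w2y)].
Proof.
move=> Hm N1 N2 w1 w2 w12 top.
have D0 := sd_ge0 p m.
have extR v : inL n p -> sqd m v = sd p m ^+ 2 ->
    (forall c, inline n c -> sqd c v <= sd p c ^+ 2) -> source p (incol n.+1) m v.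
  move=> Hp E H; split => // x; rewrite incolS => /andP[_ Hx].
  have [c Hc Ec] := crossing Hp Hx; exact: extend_source (H c Hc) Ec.
have extL v : inR n p -> sqd m v = sd p m ^+ 2 ->
    (forall c, inline n c -> sqd c v <= sd p c ^+ 2) -> source p (incol n) m v.
  move=> Hp E H; split => // x /incol_inL Hx.
  have [c Hc Ec] := crossing Hx Hp; apply: extend_source (H c Hc) _.
  by rewrite (sdC p x) Ec (sdC x c) (sdC c p) addrC.
have straight : w1y + w2y = 0 -> w2x = - w1x /\ w2y = - w1y.
  move=> Z; have Ey : w2y = - w1y by lra.
  split => //; apply/eqP; rewrite -(@eqrXn2 _ 2) //; last by lra.
  by apply/eqP; rewrite sqrrN; move: N2; rewrite Ey sqrrN -N1 => /addIr.
have low (v v' : R * R) : m.2 = (ht n)%:R -> sqd m v = sqd m v' ->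
    m.2 - v.2 <= m.2 - v'.2 -> forall c, inline n c -> sqd c v' <= sqd c v.
  move=> mt S L c Hc; have /andP[/andP[_ c2] _] := Hc; rewrite -mt in c2.
  have c1 := inline1 Hc; rewrite -(inline1 Hm) in c1.
  have T u : sqd c u = sqd m u + 2 * (m.2 - u.2) * (c.2 - m.2)
    + (c.2 - m.2) ^+ 2 by rewrite /sqd c1; ring.
  have : 0 <= (v.2 - v'.2) * (m.2 - c.2) by apply: mulr_ge0; lra.
  by rewrite !T S; lra.
have [Hp|Hp] := inLR n p.
- have [v V v1] := line_source_right Hp Hm; have [VE VA] := V.
  case: top => [/straight[-> ->]|mt].
    exists v, v; split => //; last by lra.
    by apply: extR => // c /inline_incol /VA.
  have [||||||||ux [uy [U1 U2 U3]]] := @turn_source R (sd p m) w1x w1y w2x w2y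
    (m.1 - v.1) (m.2 - v.2) => //.
    by rewrite subr_ge0.
  exists v, (m.1 - ux, m.2 - uy); rewrite /= !subKr; split => //.
  have E : sqd m (m.1 - ux, m.2 - uy) = sd p m ^+ 2 by rewrite /sqd /= !subKr.
  apply: extR => // c Hc; apply: le_trans (VA c (inline_incol Hc)).
  by apply: low Hc => //; rewrite ?VE ?E //= subKr.
- have [v V v1] := line_source_left Hp Hm; have [VE VA] := V.
  case: top => [/straight[-> ->]|mt].
    exists v, v; split => //; last by lra.
    by apply: extL => // c /inline_incolS /VA.
  have [||||||||ux [uy [U1 U2 U3]]] := @turn_sourceN R (sd p m) w1x w1y w2x w2y
    (m.1 - v.1) (m.2 - v.2) => //.
    by rewrite subr_le0.
  exists (m.1 - ux, m.2 - uy), v; rewrite /= !subKr; split => //.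
  have E : sqd m (m.1 - ux, m.2 - uy) = sd p m ^+ 2 by rewrite /sqd /= !subKr.
  apply: extL => // c Hc; apply: le_trans (VA c (inline_incolS Hc)).
  by apply: low Hc => //; rewrite ?VE ?E //= subKr.
Qed.

(** [s1] and [s2] are the slopes at [m], towards [a] and [c], of half the squared distances to the
    two sources. In the weighted sum of the bounds at [a] and [c] they contribute [2 x y (s1 + s2)],
    which is nonnegative. *)
Lemma stew_break n p a m c : inline n m -> incol n a -> incol n.+1 c ->
  a <> m -> m <> c -> sd a c = sd a m + sd m c -> stew p a m c.
Proof.
move=> Hm Ha Hc am mc E.
have [w0 top] := turn_up Hm Ha Hc am mc E erefl erefl.
have Am : sd a m = ed a m := sd_incol Ha (inline_incol Hm).
have Mc : sd m c = ed m c := sd_incol (inline_incolS Hm) Hc.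
have x0 : 0 < ed a m by apply: ed_gt0 => /pt_inj.
have y0 : 0 < ed m c by apply: ed_gt0 => /pt_inj.
have X := sqr_ed a m; have Y := sqr_ed m c.
rewrite /stew Am Mc; clear Am Mc.
set x := ed a m in w0 top x0 X *; set y := ed m c in w0 top y0 Y *.
have xn : x != 0 by rewrite gt_eqF.
have yn : y != 0 by rewrite gt_eqF.
have [||||v1 [v2 [[V1 A1] [V2 A2] S]]] := @turn_sources p n m
  ((a.1 - m.1) / x) ((a.2 - m.2) / x) ((c.1 - m.1) / y) ((c.2 - m.2) / y) Hm
  _ _ _ _ w0 top.
- rewrite !exprMn -mulrDl exprVn X /sqd divff //.
  by move: (expf_neq0 2 xn); rewrite X.
- rewrite !exprMn -mulrDl exprVn Y sqdC /sqd divff //.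
  by move: (expf_neq0 2 yn); rewrite Y sqdC.
- rewrite pmulr_lle0 ?invr_gt0 // subr_le0 (inline1 Hm).
  by case/and3P: Ha.
- rewrite pmulr_lge0 ?invr_gt0 // subr_ge0 (inline1 Hm).
  by case/andP: Hc.
have {A1} := A1 a Ha; have {A2} := A2 c Hc.
set s1 := (m.1 - v1.1) * _ + _ in S; set s2 := (m.1 - v2.1) * _ + _ in S.
have -> : sqd a v1 = sqd m v1 + 2 * x * s1 + x ^+ 2.
  by rewrite X /s1 /sqd; field.
have -> : sqd c v2 = sqd m v2 + 2 * y * s2 + y ^+ 2.
  by rewrite Y /s2 /sqd; field.
rewrite V1 V2 => A2 A1.
have := ler_wpM2l (ltW y0) A1; have := ler_wpM2l (ltW x0) A2.
have := mulr_ge0 (mulr_ge0 (ltW x0) (ltW y0)) S; lra.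
Qed.

End Break.

(** * Geodesics *)

Section Geodesics.
Variable R : realType.
Implicit Types (p q r z a c m : stair R) (g : R -> stair R) (n i k : nat).

Lemma mdistE p q : mdist p q = sd p q.
Proof. by []. Qed.

Lemma geodesic_sd q r g (s t : R) : geodesic q r g -> 0 <= s -> s <= t ->
  t <= sd q r -> sd (g s) (g t) = t - s.
Proof.
move=> [_ _ H] s0 st tL; rewrite -mdistE H ?mdistE.
- by rewrite distrC ger0_norm // subr_ge0.
- by rewrite s0 (le_trans st).
- by rewrite tL (le_trans s0).
Qed.

Lemma geodesic_of_sd q r g : g 0 = q -> g (sd q r) = r ->
  (forall s t, 0 <= s -> s <= t -> t <= sd q r -> sd (g s) (g t) = t - s) ->
  geodesic q r g.
Proof.
move=> g0 gL H; split => // s t; rewrite !mdistE => /andP[s0 sL] /andP[t0 tL].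
case: (leP s t) => st; first by rewrite H // distrC ger0_norm // subr_ge0.
by rewrite sdC H ?(ltW st) // ger0_norm // subr_ge0 ltW.
Qed.

Lemma geodesic_between q r g (t : R) : geodesic q r g -> 0 <= t <= sd q r ->
  sd q (g t) = t /\ sd (g t) r = sd q r - t.
Proof.
move=> G /andP[t0 tL]; have [g0 gL _] := G; split.
  by rewrite -g0 (geodesic_sd G) // subr0.
by rewrite -[r in LHS]gL mdistE (geodesic_sd G).
Qed.

Lemma geodesic_rev q r g : geodesic q r g -> geodesic r q (fun t => g (sd q r - t)).
Proof.
move=> G; have [g0 gL _] := G; apply: geodesic_of_sd.
- by rewrite subr0.
- by rewrite (sdC r) subrr.
- move=> s t s0 st; rewrite (sdC r) => tL.
  by rewrite sdC (geodesic_sd G); lra.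
Qed.

Lemma incol_geodesic n a c : incol n a -> incol n c -> exists g, geodesic a c g.
Proof.
move=> Ha Hc; have E := sd_incol Ha Hc; have S := sqr_ed a c; rewrite -E in S.
have [L0|L0] := eqVneq (sd a c) 0.
  exists (fun _ => a); apply: geodesic_of_sd => //; first exact: sd_eq0.
  by move=> s t s0 st; rewrite L0 sdxx; lra.
have P : 0 < sd a c by rewrite lt_def L0 sd_ge0.
set L := sd a c in S L0 P *.
pose h (t : R) := (a.1 + t / L * (c.1 - a.1), a.2 + t / L * (c.2 - a.2)).
pose g t : stair R := insubd a (h t).
have gE t : 0 <= t <= L -> (g t : R * R) = h t /\ incol n (g t).
  move=> /andP[t0 tL].
  have u0 : 0 <= t / L by rewrite divr_ge0 // ltW.
  have u1 : t / L <= 1 by rewrite ler_pdivrMr // mul1r.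
  have /and3P[a1 a2 a3] := Ha; have /and3P[c1 c2 c3] := Hc.
  have a4 := pt2_ge0 a; have c4 := pt2_ge0 c.
  have [||z zE Hz] := @incol_exists R n (h t).1 (h t).2.
  - by apply/andP; split; rewrite /h /=; nra.
  - by apply/andP; split; rewrite /h /=; nra.
  have -> : g t = z.
    by apply: pt_inj; rewrite zE insubdK //; have := ptP z; rewrite zE.
  by rewrite zE; case: (h t).
exists g; apply: geodesic_of_sd.
- have [|H _] := gE 0; first by rewrite lexx ltW.
  by apply: pt_inj; rewrite H /h !mul0r !addr0; case: (pt a).
- have [|H _] := gE L; first by rewrite lexx ltW.
  by apply: pt_inj; rewrite H /h divff // !mul1r !subrKC; case: (pt c).
- move=> s t s0 st tL.
  have [|Hs Cs] := gE s; first by rewrite s0 (le_trans st).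
  have [|Ht Ct] := gE t; first by rewrite tL (le_trans s0).
  rewrite (sd_incol Cs Ct); apply: ed_eq; first by rewrite subr_ge0.
  rewrite Hs Ht /sqd /h /=.
  transitivity (((t - s) / L) ^+ 2 * sqd a c); first by rewrite /sqd; ring.
  by rewrite -S exprMn exprVn mulfVK // expf_neq0.
Qed.

(* By Stewart's identity this is an affine function of t in the plane. *)
Definition sqdist_defect p g (t : R) := sd p (g t) ^+ 2 - t ^+ 2.

Lemma stew_cvx3 p g (x y z : R) : sd (g x) (g y) = y - x ->
  sd (g y) (g z) = z - y ->
  stew p (g x) (g y) (g z) <-> cvx3 (sqdist_defect p g) x y z.
Proof. by rewrite /stew /cvx3 /sqdist_defect => -> ->; split; lra. Qed.

(** Seen from [z] itself, the right-hand side of Stewart's inequality is 0. *)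
Lemma stew_uniq a c z z' : sd a z = sd a z' -> sd z c = sd z' c ->
  stew z a z' c -> z = z'.
Proof.
move=> E1 E2; rewrite /stew (sdC z a) E1 E2.
set x := sd a z' in E1 *; set y := sd z' c in E2 *.
have x0 : 0 <= x := sd_ge0 _ _; have y0 : 0 <= y := sd_ge0 _ _.
have [S|S] := eqVneq (x + y) 0.
  by move=> _; rewrite -(@sd_eq0 R a z) ?E1; [apply: sd_eq0; rewrite -/x; lra|lra].
have P : 0 < x + y by rewrite lt_def S addr_ge0.
have -> : y * x ^+ 2 + x * y ^+ 2 - x * y * (x + y) = 0 by ring.
rewrite pmulr_rle0 // => H; apply: sd_eq0; apply/eqP.
by rewrite -sqrf_eq0 eq_le H sqr_ge0.
Qed.

Lemma geodesic_subsd q r g (s t : R) : geodesic q r g -> 0 <= s -> s <= t ->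
  t <= sd q r -> sd q (g s) = s /\ sd (g s) (g t) = t - s /\ sd (g t) r = sd q r - t.
Proof.
move=> G s0 st tL; have [|A _] := geodesic_between (t := s) G; first by lra.
by have [|_ B] := geodesic_between (t := t) G; [lra|rewrite (geodesic_sd G)].
Qed.

Lemma geodesic_concat q c r g1 g2 : geodesic q c g1 -> geodesic c r g2 ->
  sd q r = sd q c + sd c r -> exists g, [/\ geodesic q r g,
    (forall t, t <= sd q c -> g t = g1 t) &
    (forall t, sd q c <= t -> g t = g2 (t - sd q c))].
Proof.
move=> G1 G2 E; have T0 := sd_ge0 q c; have L2 := sd_ge0 c r.
have [g10 g1T _] := G1; have [g20 g2L _] := G2; rewrite !mdistE in g1T g2L.
set T := sd q c in E T0 g1T *.
pose g t := if t <= T then g1 t else g2 (t - T).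
have gl t : t <= T -> g t = g1 t by rewrite /g => ->.
have gr t : T <= t -> g t = g2 (t - T).
  rewrite /g; case: ifP => // tT Tt.
  have -> : t = T by lra.
  by rewrite subrr g1T g20.
exists g; split => //; apply: geodesic_of_sd.
- by rewrite gl.
- rewrite gr E; last by lra.
  by have -> : T + sd c r - T = sd c r by ring.
move=> s t s0 st; rewrite E => tL.
case: (leP t T) => tT.
  by rewrite !gl //; [apply: geodesic_sd G1 _ _ _|lra].
case: (leP T s) => sT.
  have Tt : T <= t by lra.
  by rewrite !gr // (geodesic_sd G2); lra.
rewrite (gl s) ?(gr t); [|lra|lra].
have [||A [_ B]] := @geodesic_subsd _ _ _ s s G1 s0; rewrite -/T; [lra|lra|].
have [|||C [_ D]] := @geodesic_subsd _ _ _ (t - T) (t - T) G2; [lra|lra|lra|].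
rewrite -/T in B.
have := sd_triangle c (g1 s) (g2 (t - T)).
have := sd_triangle (g1 s) q r; have := sd_triangle (g2 (t - T)) (g1 s) r.
lra.
Qed.

Lemma incol_geodesic_between n a c g (t : R) : incol n a -> incol n c ->
  geodesic a c g -> 0 <= t <= sd a c -> incol n (g t).
Proof.
move=> Ha Hc G Ht; have [g1 g2] := geodesic_between G Ht.
by have [|//] := @incol_between _ n a (g t) c Ha Hc; lra.
Qed.

Lemma incol_geodesic_cvx n a c p : incol n a -> incol n c ->
  forall g, geodesic a c g -> cvx_on (sqdist_defect p g) 0 (sd a c).
Proof.
move=> Ha Hc g G x y z x0 xy yz zL.
have XY : sd (g x) (g y) = y - x by apply: geodesic_sd G _ _ _; lra.
have YZ : sd (g y) (g z) = z - y by apply: geodesic_sd G _ _ _; lra.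
apply/stew_cvx3 => //; apply: (@stew_incol _ n).
- by apply: incol_geodesic_between G _ => //; lra.
- by apply: incol_geodesic_between G _ => //; lra.
- by rewrite XY YZ (geodesic_sd G); lra.
Qed.

(** Convexity along [g] as seen from [c'] leaves no second point at the same distances from [q] and
    [c]. *)
Lemma geodesic_through q c c' g : geodesic q c g ->
  (forall p, cvx_on (sqdist_defect p g) 0 (sd q c)) ->
  sd q c = sd q c' + sd c' c -> c' <> c -> g (sd q c') = c'.
Proof.
move=> G F E c'c; have [g0 gL _] := G; rewrite mdistE in gL.
have P : 0 < sd c' c by rewrite lt_def sd_ge0 andbT; apply/eqP => /sd_eq0.
have Q := sd_ge0 q c'.
have [q0|q0] := eqVneq (sd q c') 0; first by rewrite q0 g0; apply: sd_eq0.
have [|A B] := geodesic_between (t := sd q c') G; first by lra.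
apply/esym/(@stew_uniq q c); [lra|lra|].
rewrite -[q in stew _ q]g0 -[c in stew _ _ _ c]gL.
apply/stew_cvx3; first by rewrite g0 A subr0.
  by rewrite gL B.
by apply: F => //; [rewrite lt_def q0|lra].
Qed.

(* The geodesic ends with a nontrivial piece in the column left of the line of c. *)
Lemma geodesic_end_incol i k n q c g : n = (i + k)%N -> incol i q ->
  inline n c -> q <> c -> geodesic q c g ->
  (forall p, cvx_on (sqdist_defect p g) 0 (sd q c)) ->
  exists T', [/\ 0 <= T', T' < sd q c & forall t, T' <= t <= sd q c -> incol n (g t)].
Proof.
move=> En Hq Hc qc G F.
have near c' : incol n c' -> sd q c = sd q c' + sd c' c -> c' <> c ->
    exists T', [/\ 0 <= T', T' < sd q c &
      forall t, T' <= t <= sd q c -> incol n (g t)].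
  move=> Hc' E' c'c; exists (sd q c').
  have P : 0 < sd c' c by rewrite lt_def sd_ge0 andbT; apply/eqP => /sd_eq0.
  have Q := sd_ge0 q c'.
  split => //; first by lra.
  have gc := geodesic_through G F E' c'c.
  move=> t /andP[t0 tT].
  have [_ [A B]] := geodesic_subsd G Q t0 tT; rewrite gc in A.
  by have [|//] := @incol_between _ n c' (g t) c Hc' (inline_incol Hc); lra.
case: k En => [|k] En.
  by apply: (near q); rewrite ?sdxx ?add0r // En addn0.
have qL' : inL (i + k) q by apply: inL_mono (incol_inL Hq); apply: leq_addr.
rewrite addnS in En.
have [|c' Hc' E'] := @crossing _ (i + k) q c qL'.
  by rewrite /inR (inline1 Hc) ler_nat En.
apply: (near c') => //; first by rewrite En; apply: inline_incolS.
move=> c'c; have := inline1 Hc; rewrite -c'c (inline1 Hc') En => /eqP.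
by rewrite eqr_nat; lia.
Qed.

(** Induction on the number of columns, splitting at the crossing point [c]. At [c], [stew_break]
    only supplies triples whose ends lie in the two adjacent columns; so the pieces are glued on
    [[T', sd q r]] first and then joined to [[0, T]] through the overlap [[T', T]]. *)
Lemma geodesic_cvx k i q r : incol i q -> incol (i + k) r ->
  exists2 g, geodesic q r g & forall p, cvx_on (sqdist_defect p g) 0 (sd q r).
Proof.
have base n a c : incol n a -> incol n c -> exists2 g, geodesic a c g &
    forall p, cvx_on (sqdist_defect p g) 0 (sd a c).
  move=> Ha Hc; have [g G] := incol_geodesic Ha Hc; exists g => // p.
  exact: (incol_geodesic_cvx _ Ha Hc).
elim: k r => [|k IH] r Hq Hr; first by rewrite addn0 in Hr; apply: base Hq Hr.
rewrite addnS in Hr; set n := (i + k)%N in Hr IH.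
have qL : inL n q by apply: inL_mono (incol_inL Hq); apply: leq_addr.
have [c Hc E] : exists2 c, inline n c & sd q r = sd q c + sd c r.
  by apply: crossing => //; move: Hr; rewrite incolS => /andP[].
have [cr|cr] := pselect (c = r).
  by apply: IH => //; rewrite -cr; apply: inline_incol.
have [qc|qc] := pselect (q = c).
  by apply: base Hr; rewrite qc; apply: inline_incolS.
have [g1 G1 F1] := IH c Hq (inline_incol Hc).
have [g2 G2 F2] := base _ _ _ (inline_incolS Hc) Hr.
have [T' [T'0 T'T incl]] := geodesic_end_incol (erefl n) Hq Hc qc G1 F1.
have L2 := sd_ge0 c r.
have [g [G gl gr]] := geodesic_concat G1 G2 E.
exists g => // p; have [_ g1T _] := G1; rewrite mdistE in g1T.
have gT : g (sd q c) = c by rewrite gl // g1T.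
set T := sd q c in E F1 T'T incl gl gr g1T gT.
have cvxl : cvx_on (sqdist_defect p g) 0 T.
  move=> x y z x0 xy yz zT; rewrite /cvx3 /sqdist_defect !gl; [|lra|lra|lra].
  exact: F1.
have TL : T <= sd q r by lra.
apply: (@cvx_on_overlap _ _ 0 T' T) => //.
apply: (@cvx_on_glue _ _ _ T) => //.
- by move=> x y z xT' xy yz zT; apply: cvxl => //; lra.
- move=> x y z x0 xy yz zL.
  have Ty : T <= y by lra.
  have Tz : T <= z by lra.
  apply/stew_cvx3; try by apply: geodesic_sd G _ _ _; lra.
  rewrite !gr //; apply/stew_cvx3; try by rewrite (geodesic_sd G2); lra.
  by apply: F2; lra.
move=> x z T'x xT Tz zL.
have XT : sd (g x) c = T - x by rewrite -gT; apply: geodesic_sd G _ _ _; lra.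
have TZ : sd c (g z) = z - T by rewrite -gT; apply: geodesic_sd G _ _ _; lra.
apply/stew_cvx3; rewrite gT //.
have T'xT : T' <= x <= T by lra.
have gx : incol n (g x) by rewrite gl; [apply: incl|lra].
have gz : incol n.+1 (g z).
  rewrite gr; last exact: ltW.
  by apply: (incol_geodesic_between (inline_incolS Hc) Hr G2); lra.
have ax : g x <> c by move=> H; move: XT; rewrite H sdxx; lra.
have az : c <> g z by move=> H; move: TZ; rewrite H sdxx; lra.
apply: (stew_break p Hc gx gz ax az).
by rewrite XT TZ (geodesic_sd G); lra.
Qed.

Lemma incol_le q r : exists i k, (incol i q /\ incol (i + k) r) \/
  (incol i r /\ incol (i + k) q).
Proof.
have A := incol_truncn q; have B := incol_truncn r.
case: (leqP (Num.truncn q.1) (Num.truncn r.1)) => H.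
  by exists (Num.truncn q.1), (Num.truncn r.1 - Num.truncn q.1)%N; left; rewrite subnKC.
exists (Num.truncn r.1), (Num.truncn q.1 - Num.truncn r.1)%N; right.
by rewrite subnKC // ltnW.
Qed.

Lemma geodesic_exists q r : exists g, geodesic q r g.
Proof.
have [i [k [[A B]|[A B]]]] := incol_le q r; have [g G _] := geodesic_cvx A B.
  by exists g.
by eexists; apply: geodesic_rev G.
Qed.

(** By [stew_uniq], any such [z] lies on the geodesic of [geodesic_cvx]. *)
Lemma stewart p a z c : sd a z + sd z c = sd a c -> stew p a z c.
Proof.
wlog [i [k [Ha Hc]]] : a c / exists i k, incol i a /\ incol (i + k) c.
  move=> W E; have [i [k [H|H]]] := incol_le a c; first by apply: W; eauto.
  by apply: stew_sym; apply: W; [eauto|rewrite (sdC c a) -E sdC (sdC z a) addrC].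
move=> E; have [g G F] := geodesic_cvx Ha Hc; have [g0 gL _] := G.
rewrite mdistE in gL.
have x0 := sd_ge0 a z; have y0 := sd_ge0 z c.
have [X0|X0] := eqVneq (sd a z) 0.
  by rewrite /stew X0; have -> := sd_eq0 X0; lra.
have [Y0|Y0] := eqVneq (sd z c) 0.
  by rewrite /stew Y0; have -> := sd_eq0 Y0; lra.
have xp : 0 < sd a z by rewrite lt_def X0.
have yp : 0 < sd z c by rewrite lt_def Y0.
have [|A B] := geodesic_between G (t := sd a z); first by lra.
have S p' : stew p' a (g (sd a z)) c.
  rewrite -[a in stew _ a]g0 -[c in stew _ _ _ c]gL.
  apply/stew_cvx3; first by rewrite g0 A subr0.
    by rewrite gL B.
  by apply: F => //; lra.
have -> : z = g (sd a z) by apply: (@stew_uniq a c); [|lra|apply: S].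
exact: S.
Qed.

End Geodesics.

(** * CAT(0) and the boundary at infinity *)

Section NonpositiveCurvature.
Variable R : realType.
Implicit Types (A B C P Q X Y Z p q x y : stair R) (s t : R) (g : R -> stair R).

Definition at_frac A B x s :=
  [/\ 0 <= s <= 1, sd A x = s * sd A B & sd x B = (1 - s) * sd A B].

Lemma at_frac_sym A B x s : at_frac A B x s -> at_frac B A x (1 - s).
Proof.
move=> [s01 H1 H2]; split; first by lra.
  by rewrite (sdC B x) (sdC B A).
by rewrite subKr (sdC x A) (sdC B A).
Qed.

Lemma at_frac_stew p A B x s : at_frac A B x s ->
  sd p x ^+ 2 <= (1 - s) * sd p A ^+ 2 + s * sd p B ^+ 2 - s * (1 - s) * sd A B ^+ 2.
Proof.
move=> [s01 H1 H2]; have [L0|L0] := eqVneq (sd A B) 0.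
  move: H1; rewrite L0 mulr0 => /sd_eq0 <-; rewrite -(sd_eq0 L0); lra.
have P : 0 < sd A B by rewrite lt_def L0 sd_ge0.
have := @stewart _ p A x B; rewrite /stew H1 H2 => S.
rewrite -(ler_pM2l P).
have {}S := S ltac:(by ring).
lra.
Qed.

(** Stewart's inequality is used twice: for [x] on the side [A B] seen from [y], and for [y] on the
    side [A C] seen from [B]. The bound is the squared distance of the comparison points. *)
Lemma at_frac_compare A B C x y s t : at_frac A B x s -> at_frac A C y t ->
  sd x y ^+ 2 <= s ^+ 2 * sd A B ^+ 2 + t ^+ 2 * sd A C ^+ 2
    - s * t * (sd A B ^+ 2 + sd A C ^+ 2 - sd B C ^+ 2).
Proof.
move=> Hx Hy; have [/andP[s0 s1] _ _] := Hx; have [_ yA _] := Hy.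
have S1 := at_frac_stew y Hx; have S2 := at_frac_stew B Hy.
rewrite (sdC x y); apply: le_trans S1 _.
rewrite (sdC y A) yA (sdC y B) in S2 *; rewrite (sdC B A) in S2.
have := ler_wpM2l s0 S2; lra.
Qed.

Lemma geodesic_frac A B g t : geodesic A B g -> 0 <= t <= sd A B ->
  at_frac A B (g t) (t / sd A B).
Proof.
move=> G Ht; have [H1 H2] := geodesic_between G Ht; case/andP: Ht => t0 tL.
have [L0|L0] := eqVneq (sd A B) 0.
  have t00 : t = 0 by lra.
  by rewrite /at_frac H1 H2 L0 t00 mul0r !mulr0 subr0; split => //; lra.
have P : 0 < sd A B by rewrite lt_def L0 sd_ge0.
split.
- by rewrite divr_ge0 ?sd_ge0 //= ler_pdivrMr // mul1r.
- by rewrite H1 divfK.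
- by rewrite H2 mulrBl mul1r divfK.
Qed.

Lemma at_frac_exists A B s : 0 <= s <= 1 -> exists x, at_frac A B x s.
Proof.
move=> /andP[s0 s1]; have [g G] := geodesic_exists A B; have L := sd_ge0 A B.
exists (g (s * sd A B)); have [|H1 H2] := geodesic_between (t := s * sd A B) G.
  by rewrite mulr_ge0 //= ler_piMl.
by split; rewrite ?s0 // H2; ring.
Qed.

Definition row_pair (u : 'rV[R]_2) : R * R := (u ord0 ord0, u ord0 ord_max).

Lemma eucl_dist_row_pair (u v : 'rV[R]_2) :
  eucl_dist u v = ed (row_pair u) (row_pair v).
Proof.
rewrite /eucl_dist /ed /sqd /row_pair /= big_ord_recl big_ord1.
by congr (Num.sqrt (_ + (u _ _ - v _ _) ^+ 2)); apply: val_inj.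
Qed.

Lemma eucl_distC (u v : 'rV[R]_2) : eucl_dist u v = eucl_dist v u.
Proof. by rewrite !eucl_dist_row_pair edC. Qed.

Definition on_side A B (a b : 'rV[R]_2) x (x' : 'rV[R]_2) :=
  exists2 s, at_frac A B x s & x' = a + s *: (b - a).

Lemma on_side_sym A B a b x (x' : 'rV[R]_2) : on_side A B a b x x' -> on_side B A b a x x'.
Proof.
move=> [s /at_frac_sym H ->]; exists (1 - s) => //.
by apply/rowP => i; rewrite !mxE; ring.
Qed.

Lemma comparison_point_on_side A B g a b x (x' : 'rV[R]_2) : geodesic A B g ->
  comparison_point A B g a b x x' -> on_side A B a b x x'.
Proof. by move=> G [t [Ht -> ->]]; exists (t / sd A B) => //; apply: geodesic_frac. Qed.

Lemma on_side_compare A B C a b c x y (x' y' : 'rV[R]_2) : eucl_dist a b = sd A B ->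
  eucl_dist a c = sd A C -> eucl_dist b c = sd B C ->
  on_side A B a b x x' -> on_side A C a c y y' -> sd x y <= eucl_dist x' y'.
Proof.
rewrite !eucl_dist_row_pair => Eab Eac Ebc [s Hx ->] [t Hy ->]; apply: le_ed.
apply: le_trans (at_frac_compare Hx Hy) _.
rewrite -Eab -Eac -Ebc !sqr_ed /sqd /row_pair /= !mxE; lra.
Qed.

Lemma CAT0_stair : CAT0 (stair R).
Proof.
split; first exact: geodesic_exists.
move=> p q r a b c Ga Gb Gc p' q' r'; rewrite !mdistE => Epq Eqr Erp comparison.
have Eqp : eucl_dist q' p' = sd q p by rewrite eucl_distC sdC.
have Erq : eucl_dist r' q' = sd r q by rewrite eucl_distC sdC.
have Epr : eucl_dist p' r' = sd p r by rewrite eucl_distC sdC.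
have E0 (z : stair R) (z' : 'rV_2) : eucl_dist z' z' = sd z z.
  by rewrite eucl_dist_row_pair edxx sdxx.
have sides x (x' : 'rV_2) : comparison x x' ->
  [\/ on_side p q p' q' x x', on_side q r q' r' x x' | on_side r p r' p' x x'].
  by move=> [H|H|H]; [apply: Or31|apply: Or32|apply: Or33];
    apply: comparison_point_on_side H.
move=> x x' y y' /sides Hx /sides Hy; rewrite mdistE.
(* Two sides share a vertex, which reversal brings to the front; a side is compared with itself
   through a degenerate triangle. *)
case: Hx => Hx; case: Hy => Hy.
- exact: on_side_compare Hx Hy.
- exact: on_side_compare (on_side_sym Hx) Hy.
- exact: on_side_compare Hx (on_side_sym Hy).
- exact: on_side_compare Hx (on_side_sym Hy).
- exact: on_side_compare Hx Hy.
- exact: on_side_compare (on_side_sym Hx) Hy.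
- exact: on_side_compare (on_side_sym Hx) Hy.
- exact: on_side_compare Hx (on_side_sym Hy).
- exact: on_side_compare Hx Hy.
Qed.

(** * Heights along rays and the boundary *)

Lemma sd_le_manhattan p q : sd p q <= `|p.1 - q.1| + `|p.2 - q.2|.
Proof. exact: sd_le_string (manhattan_string p q). Qed.

Lemma le_sd1 p q : `|p.1 - q.1| <= sd p q.
Proof. exact: le_trans (le_ed1 _ _) (ed_le_sd _ _). Qed.

Lemma le_sd2 p q : `|p.2 - q.2| <= sd p q.
Proof. exact: le_trans (le_ed2 _ _) (ed_le_sd _ _). Qed.

Lemma sd_horizontal p q : p.2 = q.2 -> sd p q = `|p.1 - q.1|.
Proof.
move=> E; apply/eqP; rewrite eq_le le_sd1 andbT.
by have := sd_le_manhattan p q; rewrite E subrr normr0 addr0.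
Qed.

Lemma sd_vertical p q : p.1 = q.1 -> sd p q = `|p.2 - q.2|.
Proof.
move=> E; apply/eqP; rewrite eq_le le_sd2 andbT.
by have := sd_le_manhattan p q; rewrite E subrr normr0 add0r.
Qed.

Definition floor_pt t : stair R := insubd (origin R) (t, 0).

Lemma floor_ptE t : 0 <= t -> (floor_pt t : R * R) = (t, 0).
Proof. by move=> t0; rewrite /floor_pt insubdK //; apply: (@region_right R (origin R)). Qed.

Lemma floor_ray : geodesic_ray floor_pt.
Proof.
by move=> s t s0 t0; rewrite mdistE sd_horizontal !floor_ptE.
Qed.

(** The quadrilateral formed by [P], [Q] and their feet on the floor is cut by the diagonal from [P]
    to the foot of [Q]. Comparison in the two triangles bounds [sd X Z] by [s * Q.2] and [sd Z Y] by
    [(1 - s) * P.2]. *)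
Lemma height_convex P Q X s : at_frac P Q X s -> X.2 <= (1 - s) * P.2 + s * Q.2.
Proof.
move=> HX; have [s01 _ _] := HX; have /andP[s0 s1] := s01.
have P1 := pt1_ge0 P; have Q1 := pt1_ge0 Q.
have P2 := pt2_ge0 P; have Q2 := pt2_ge0 Q.
pose P0 := floor_pt P.1; pose Q0 := floor_pt Q.1.
have PE : (P0 : R * R) = (P.1, 0) := floor_ptE P1.
have QE : (Q0 : R * R) = (Q.1, 0) := floor_ptE Q1.
have [Z HZ] := at_frac_exists P Q0 s01.
pose m := (1 - s) * P.1 + s * Q.1.
have m0 : 0 <= m by rewrite addr_ge0 // mulr_ge0 //; lra.
pose Y := floor_pt m; have YE : (Y : R * R) = (m, 0) := floor_ptE m0.
have HY : at_frac P0 Q0 Y s.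
  split => //; rewrite !sd_horizontal ?PE ?QE ?YE //=.
    rewrite -[s in RHS]ger0_norm // -normrM; congr `|_|; rewrite /m; ring.
  have s1' : 0 <= 1 - s by lra.
  rewrite -[1 - s in RHS]ger0_norm // -normrM; congr `|_|; rewrite /m; ring.
have XZ : sd X Z <= s * Q.2.
  rewrite -ler_sqr ?nnegrE ?sd_ge0 ?mulr_ge0 //.
  apply: le_trans (at_frac_compare HX HZ) _.
  have -> : sd Q Q0 = Q.2 by rewrite sd_vertical QE //= subr0 ger0_norm.
  by lra.
have ZY : sd Z Y <= (1 - s) * P.2.
  rewrite -ler_sqr ?nnegrE ?sd_ge0 ?mulr_ge0 //; last by lra.
  apply: le_trans (at_frac_compare (at_frac_sym HZ) (at_frac_sym HY)) _.
  have -> : sd P P0 = P.2 by rewrite sd_vertical PE //= subr0 ger0_norm.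
  by lra.
have := le_sd2 X Y; rewrite YE subr0 ger0_norm ?pt2_ge0 //.
have := sd_triangle Z X Y; lra.
Qed.

Lemma height_sublinear p : p.2 ^+ 2 <= 4 * (p.1 + 1).
Proof.
have /and3P[_ _ H] := incol_truncn p; set n := Num.truncn _ in H.
apply: (@le_trans _ _ ((ht n)%:R ^+ 2)).
  by rewrite ler_sqr ?nnegrE // pt2_ge0.
have := ht_sublinear n; rewrite -(ler_nat R) natrX natrM -[n.+1%:R]natr1 => /le_trans; apply.
by rewrite ler_pM2l // lerD2r; have /andP[] := truncn_itv (pt1_ge0 p).
Qed.

Lemma ray_height g t : geodesic_ray g -> 0 <= t -> (g t).2 <= (g 0).2.
Proof.
move=> G t0; rewrite leNgt; apply/negP => gt.
have [t00|t00] := eqVneq t 0; first by rewrite t00 ltxx in gt.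
have tp : 0 < t by rewrite lt_def t00.
set d := (g t).2 - (g 0).2; have d0 : 0 < d by rewrite subr_gt0.
set x0 := (g 0).1; have x00 : 0 <= x0 := pt1_ge0 _.
(* [M] and [T] are chosen so that [t ^+ 2 * 4 (x0 + T + 1) < (d * T) ^+ 2]: at time [T] convexity
   demands more height than [height_sublinear] allows. *)
set M := 4 * t ^+ 2 * (x0 + 2).
have M0 : 0 <= M by rewrite !mulr_ge0 ?sqr_ge0 //; lra.
have d2 : 0 < d ^+ 2 by rewrite exprn_gt0.
pose T := t + 1 + M / d ^+ 2.
have Md : 0 <= M / d ^+ 2 by rewrite divr_ge0 // ltW.
have Tt : t <= T by rewrite /T; lra.
have T1 : 1 <= T by rewrite /T; lra.
have dT : M < d ^+ 2 * T.
  have -> : d ^+ 2 * T = M + d ^+ 2 * (t + 1).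
    by rewrite /T mulrDr mulrCA mulfV ?mulr1 1?addrC // gt_eqF.
  by rewrite ltrDl mulr_gt0 //; lra.
have Tp : 0 < T by lra.
have S (u v : R) : 0 <= u -> u <= v -> sd (g u) (g v) = v - u.
  move=> u0 uv; rewrite -mdistE G //; last by lra.
  by rewrite distrC ger0_norm // subr_ge0.
have F : at_frac (g 0) (g T) (g t) (t / T).
  split; rewrite ?S ?subr0 //; try lra.
  - by rewrite divr_ge0 //= ?ler_pdivrMr ?mul1r //; lra.
  - by rewrite divfK // gt_eqF.
  - by rewrite mulrBl mul1r divfK // gt_eqF.
have := height_convex F; have Y0 := pt2_ge0 (g 0); have YT := pt2_ge0 (g T).
set yT := (g T).2 in YT * => H.
have : d <= t / T * yT.
  have : 0 <= t / T * (g 0).2 by rewrite !mulr_ge0 // invr_ge0 ltW.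
  by rewrite /d; lra.
rewrite mulrAC ler_pdivlMr // => dyT.
have dT0 : 0 <= d * T by rewrite mulr_ge0 // ltW.
have : (d * T) ^+ 2 <= (t * yT) ^+ 2 by rewrite ler_sqr ?nnegrE // mulr_ge0.
rewrite !exprMn; have Hs := height_sublinear (g T); rewrite -/yT in Hs.
have xT : (g T).1 <= x0 + T.
  have := le_sd1 (g 0) (g T); rewrite S ?(ltW Tp) // subr0 distrC.
  by move=> /(le_trans (ler_norm _)); rewrite /x0; lra.
have : t ^+ 2 * yT ^+ 2 <= t ^+ 2 * (4 * (x0 + T + 1)).
  by apply: ler_wpM2l; [exact: sqr_ge0|lra].
have : M * T < d ^+ 2 * T * T by rewrite ltr_pM2r.
have : 4 * t ^+ 2 * (x0 + T + 1) <= M * T.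
  have -> : M * T = 4 * t ^+ 2 * ((x0 + 2) * T) by rewrite /M mulrA.
  rewrite ler_wpM2l ?mulr_ge0 ?sqr_ge0 //.
  have : 0 <= (x0 + 1) * (T - 1) by rewrite mulr_ge0; lra.
  lra.
rewrite (expr2 T) mulrA; lra.
Qed.

(** As the height stays in [[0, y0]], the horizontal displacement is [t] up to [y0]; to the left it
    is at most [x0], which then bounds [t]. *)
Lemma ray_asymptotic_floor g : geodesic_ray g ->
  exists C : R, forall t, 0 <= t -> sd (g t) (floor_pt t) <= C.
Proof.
move=> G; set x0 := (g 0).1; set y0 := (g 0).2; exists (x0 + 2 * y0) => t t0.
have x00 : 0 <= x0 := pt1_ge0 _; have y00 : 0 <= y0 := pt2_ge0 _.
have := sd_le_manhattan (g t) (floor_pt t); rewrite floor_ptE //= subr0.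
have yt : 0 <= (g t).2 := pt2_ge0 _; have xt : 0 <= (g t).1 := pt1_ge0 _.
rewrite (ger0_norm yt).
have := ray_height G t0; rewrite -/y0 => yy.
have S : sd (g 0) (g t) = t.
  by rewrite -mdistE G // sub0r normrN ger0_norm.
have := le_sd1 (g 0) (g t); rewrite S ler_norml -/x0 => /andP[A B].
have := sd_le_manhattan (g 0) (g t); rewrite S -/x0 -/y0.
rewrite (ger0_norm (_ : 0 <= y0 - (g t).2)) ?subr_ge0 // => D.
suff : `|(g t).1 - t| <= x0 + y0 by lra.
rewrite ler_norml; case: (lerP 0 (x0 - (g t).1)) => h.
  by rewrite (ger0_norm h) in D; apply/andP; split; lra.
by rewrite (ltr0_norm h) in D; apply/andP; split; lra.
Qed.

Lemma rays_asymptotic g g' : geodesic_ray g -> geodesic_ray g' -> asymptotic g g'.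
Proof.
move=> /ray_asymptotic_floor[C H] /ray_asymptotic_floor[C' H'].
exists (C + C') => t t0; rewrite mdistE.
have := sd_triangle (floor_pt t) (g t) (g' t); rewrite (sdC (floor_pt t)).
have := H t t0; have := H' t t0; lra.
Qed.

Lemma boundary_stair :
  boundary_at_infinity (stair R) = [set [set g | geodesic_ray g]].
Proof.
apply/seteqP; split => [S [g G ->]|S ->] /=.
  by apply/seteqP; split => [g' []|g' G'] //; split => //; apply: rays_asymptotic.
exists floor_pt; first exact: floor_ray.
apply/seteqP; split => [g' G'|g' []] //; split => //.
by apply: rays_asymptotic => //; apply: floor_ray.
Qed.

End NonpositiveCurvature.

(** * The cubical structure *)

Section Complex.
Variable R : realType.
Implicit Types (p q : stair R) (c : grid_cell).

Lemma cell_image c : cell_chart (c := c) @` @unit_cube R _ = [set p | incell c p].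
Proof.
apply/seteqP; split => [p [u U <-]|p Hp] /=; first exact: incell_chart.
by exists (cell_coord c p); [apply: cell_coord_unit|apply: cell_coordK].
Qed.

Lemma cell_chart_inj c (u v : 'rV[R]_(cell_dim c)) : unit_cube u ->
  unit_cube v -> cell_chart u = cell_chart v -> u = v.
Proof.
move=> Hu Hv E; have D := eucl_dist_chart Hu Hv; rewrite E edxx in D.
have /eqP : \sum_(i < cell_dim c) (u ord0 i - v ord0 i) ^+ 2 = 0.
  apply/eqP; rewrite eq_le sumr_ge0 => [|i _]; last exact: sqr_ge0.
  by rewrite andbT -sqrtr_eq0; apply/eqP.
rewrite psumr_eq0 => [|i _]; last exact: sqr_ge0.
move=> /allP H; apply/rowP => i; have := H i (mem_index_enum _).
by rewrite /= sqrf_eq0 subr_eq0 => /eqP.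
Qed.

Lemma cell_chartK c (u : 'rV[R]_(cell_dim c)) : unit_cube u ->
  cell_coord c (cell_chart u) = u.
Proof.
move=> U; have H := incell_chart U; apply: cell_chart_inj => //.
  exact: cell_coord_unit.
exact: cell_coordK.
Qed.

Lemma incell_box_exists n p : incol n p ->
  exists k (H : (k < ht n)%N), incell (box H) p.
Proof.
move=> Hp; have /and3P[_ _ p2] := Hp; have p0 := pt2_ge0 p.
case: (leqP (ht n) (Num.truncn p.2)) => H.
  have kn : ((ht n).-1 < ht n)%N by rewrite ltn_predL.
  exists _, kn; apply: incell_box => //; rewrite prednK // p2 andbT.
  by rewrite -truncn_ge_nat //; apply: leq_trans H; apply: leq_pred.
exists _, H; apply: incell_box => //.
by have /andP[-> /ltW ->] := truncn_itv p0.
Qed.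

Lemma cell_cover p : exists c (u : 'rV[R]_(cell_dim c)),
  unit_cube u /\ cell_chart u = p.
Proof.
have [k [H Hp]] := incell_box_exists (incol_truncn p).
exists (box H), (cell_coord (box H) p); split; first exact: cell_coord_unit.
exact: cell_coordK.
Qed.

(* A frozen coordinate [Some e] is irrelevant on a degenerate side. *)
Definition cell_face c (fx fy : option bool) (i : 'I_(cell_dim c)) : option bool :=
  match fintype.split i with inl _ => fx | inr _ => fy end.

Definition interval_face (n : nat) (b : bool) (f : option bool) (x : R) : Prop :=
  n%:R <= x <= (n + b)%:R /\
  forall e : bool, f = Some e -> b -> x = (n + e)%:R.

Lemma cell_faceP c fx fy (u : 'rV[R]_(cell_dim c)) : unit_cube u ->
  cube_face (cell_face fx fy) u <->
  interval_face (col_of c) (is_wide c) fx (cell_chart u).1 /\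
  interval_face (row_of c) (is_tall c) fy (cell_chart u).2.
Proof.
move=> U; have [I1 I2] := incell_chart U.
have sumP (b : bool) (v : 'I_b -> R) (n : nat) (f : option bool) :
  (forall e : bool, f = Some e -> b -> n%:R + \sum_i v i = (n + e)%:R) <->
  (forall i (e : bool), f = Some e -> v i = e%:R).
  split => [H i e fe|H e fe bT].
    have bT : b by case: (b) i => // -[].
    have := H e fe bT; rewrite natrD => /addrI <-.
    by case: b v i bT {H} => // v i _; rewrite big_ord1 (ord1 i).
  by case: b v bT H => // v _ H; rewrite big_ord1 (H _ e fe) natrD.
rewrite /interval_face; split.
  move=> [_ H]; split; split => //; rewrite cell_chartE //=; apply/sumP => i e fe.
    by rewrite mxE; apply: H; rewrite /cell_face (unsplitK (inl i)).
  by rewrite mxE; apply: H; rewrite /cell_face (unsplitK (inr i)).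
rewrite cell_chartE //= => -[[_ /sumP H1] [_ /sumP H2]]; split => // i e.
rewrite /cell_face; case: fintype.splitP => j ij fe.
  have -> : i = lshift _ j by apply: val_inj.
  by have := H1 j e fe; rewrite mxE.
have -> : i = rshift _ j by apply: val_inj.
by have := H2 j e fe; rewrite mxE.
Qed.

(** The face of [[n, n + b]] cut out by [[n', n' + b']] when they meet: everything if the second is
    nondegenerate and starts at [n], otherwise one end, the upper one exactly when [n'] is
    [n + 1]. *)
Definition meet_face (n n' : nat) (b b' : bool) : option bool :=
  if b' && (n' == n) then None else Some (n' == n.+1).

Lemma meet_faceP n n' (b b' : bool) (x y : R) :
  n%:R <= y <= (n + b)%:R -> n'%:R <= y <= (n' + b')%:R ->
  interval_face n b (meet_face n n' b b') x <->
  n%:R <= x <= (n + b)%:R /\ n'%:R <= x <= (n' + b')%:R.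
Proof.
move=> /andP[y1 y2] /andP[y3 y4].
have N1 : (n <= n' + b')%N by rewrite -(ler_nat R); apply: le_trans y4.
have N2 : (n' <= n + b)%N by rewrite -(ler_nat R); apply: le_trans y2.
rewrite /interval_face /meet_face; split.
  move=> [Hx H]; split => //; move: H; case: ifP => [/andP[b'1 /eqP ->] _|F H].
    rewrite b'1; case/andP: Hx => -> /= /le_trans; apply.
    by rewrite ler_nat leq_add2l; case: (b).
  case: b Hx N2 y2 H => [Hx N2 _|/andP[Hx1 Hx2] N2 _ _].
    move=> /(_ _ erefl isT) ->; rewrite !ler_nat; move: F N1 N2.
    by clear y4; case: eqP => [->|] /=; case: b' => /=; lia.
  have -> : x = n%:R by apply/eqP; rewrite eq_le Hx1 -[n in (n%:R)]addn0 Hx2.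
  by rewrite !ler_nat N1 andbT; move: N2; rewrite addn0.
move=> [Hx /andP[H1 H2]]; split => // e; case: ifP => // F [<-] b1.
rewrite b1 in Hx N2; case/andP: Hx => H3 H4; move: F N1 N2.
case: (n' =P n.+1) => [E|NE] /=.
  move=> _ _ _; rewrite -[n.+1]addn1 in E.
  by apply/eqP; rewrite eq_le H4 -E H1.
case: b' H2 {y4} => /= H2 F N1 N2.
  have NE' : n' <> n by move: F => /eqP.
  have E : n = n'.+1 by lia.
  by apply/eqP; rewrite addn0 eq_le H3 andbT E -addn1.
have E : n' = n by lia.
by apply/eqP; rewrite addn0 eq_le H3 andbT -E -(addn0 n').
Qed.

(** The gluing map is the chart of [c] followed by the inverse of that of [c']; it is isometric
    because charts preserve Euclidean distances. *)
Lemma cell_glue c c' :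
  cell_chart (c := c) @` @unit_cube R _ `&` cell_chart (c := c') @` @unit_cube R _
    !=set0 ->
  exists (F : set 'rV[R]_(cell_dim c)) (F' : set 'rV[R]_(cell_dim c'))
         (h : 'rV[R]_(cell_dim c) -> 'rV[R]_(cell_dim c')),
    [/\ is_face F, is_face F', h @` F = F',
        forall u v, F u -> F v -> eucl_dist (h u) (h v) = eucl_dist u v &
        forall u u', unit_cube u -> unit_cube u' ->
          (cell_chart u = cell_chart u' <-> F u /\ u' = h u)].
Proof.
rewrite !cell_image => -[y [/= y1 y2]].
pose F c1 c2 : set 'rV[R]_(cell_dim c1) := cube_face
  (cell_face (meet_face (col_of c1) (col_of c2) (is_wide c1) (is_wide c2))
             (meet_face (row_of c1) (row_of c2) (is_tall c1) (is_tall c2))).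
have FP c1 c2 : incell c1 y -> incell c2 y -> forall u, unit_cube u ->
    (F c1 c2 u <-> incell c2 (cell_chart u)).
  move=> [A1 A2] [B1 B2] u U; have [I1 I2] := incell_chart U.
  have X := meet_faceP (cell_chart u).1 A1 B1.
  have Y := meet_faceP (cell_chart u).2 A2 B2.
  split; first by move/(cell_faceP _ _ U) => -[/X[_ ?] /Y[_ ?]].
  by move=> [? ?]; apply/cell_faceP => //; split; [apply/X|apply/Y].
have Fu c1 c2 u : F c1 c2 u -> unit_cube u by case.
exists (F c c'), (F c' c), (fun u => cell_coord c' (cell_chart u)).
have FP1 := FP _ _ y1 y2; have FP2 := FP _ _ y2 y1.
split.
- by eexists.
- by eexists.
- apply/seteqP; split => [_ [u Hu <-]|w Hw] /=.
    have U := Fu _ _ _ Hu; have I := (FP1 u U).1 Hu.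
    apply/FP2; first exact: cell_coord_unit.
    by rewrite cell_coordK //; apply: incell_chart.
  have U := Fu _ _ _ Hw; have I := (FP2 w U).1 Hw.
  exists (cell_coord c (cell_chart w)).
    apply/FP1; first exact: cell_coord_unit.
    by rewrite cell_coordK //; apply: incell_chart.
  by rewrite cell_coordK // cell_chartK.
- move=> u v Hu Hv; have Uu := Fu _ _ _ Hu; have Uv := Fu _ _ _ Hv.
  have Iu := (FP1 u Uu).1 Hu; have Iv := (FP1 v Uv).1 Hv.
  by rewrite !eucl_dist_chart ?cell_coordK //; apply: cell_coord_unit.
- move=> u u' U U'; split => [E|[Hu ->]].
    rewrite E cell_chartK //; split => //.
    by apply/FP1 => //; rewrite E; apply: incell_chart.
  by rewrite cell_coordK //; apply/FP1.
Qed.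

Lemma interval_faceP n (b : bool) f (x : R) : (~~ b -> f = None) ->
  interval_face n b f x <->
  (n + (f == Some true))%:R <= x <=
    (n + (f == Some true) + (b && (f == None)))%:R.
Proof.
move=> Hf; rewrite /interval_face; case: f Hf => [e|] Hf /=; last first.
  by rewrite !addn0 andbT; split => [[]|].
have b1 : b by apply/negPn/negP => /Hf.
rewrite b1 andbF addn0; split.
  by move=> [_ /(_ e erefl isT)] ->; case: e {Hf}; rewrite lexx.
rewrite -eq_le => /eqP <-; split; last by move=> e' [<-] _; case: (e).
by rewrite !ler_nat leq_addr leq_add2l; case: e {Hf}.
Qed.

Lemma cell_faces c (F : set 'rV[R]_(cell_dim c)) : is_face F ->
  exists c', cell_chart (c := c') @` @unit_cube R _ = cell_chart (c := c) @` F.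
Proof.
move=> [f ->].
have pickf (b : bool) (g : 'I_b -> option bool) :
    exists o, (~~ b -> o = None) /\ forall i, g i = o.
  case: b g => g; last by exists None; split => // -[].
  by exists (g ord0); split => // i; rewrite (ord1 i).
have [fx [fx1 fx2]] := pickf _ (fun i => f (lshift _ i)).
have [fy [fy1 fy2]] := pickf _ (fun i => f (rshift _ i)).
have -> : f = cell_face fx fy.
  apply/funext => i; rewrite /cell_face; case: fintype.splitP => j ij.
    by rewrite -(fx2 j); congr f; apply: val_inj.
  by rewrite -(fy2 j); congr f; apply: val_inj.
(* Freezing a coordinate to 1 shifts the face by one row or column; the next column is at least as
   high. *)
have H : (row_of c + (fy == Some true) + (is_tall c && (fy == None))
    <= ht (col_of c + (fx == Some true)))%N.
  apply: leq_trans (leq_ht (leq_addr _ _)); apply: leq_trans (grid_cellP c).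
  rewrite -addnA leq_add2l; case: (is_tall c) fy1 => [_|/(_ isT) ->] //=.
  by case: (fy) => [[]|].
exists (@GridCell _ _ (is_wide c && (fx == None)) _ H); rewrite cell_image.
have IP (p : stair R) : incell (GridCell (is_wide c && (fx == None)) H) p <->
    interval_face (col_of c) (is_wide c) fx p.1 /\
    interval_face (row_of c) (is_tall c) fy p.2.
  by rewrite /incell /=; split => -[A B]; split; apply/interval_faceP.
apply/seteqP; split => [p /= /IP Hp|_ [u Hu <-]] /=.
  have I : incell c p by case: Hp => -[? _] [? _].
  exists (cell_coord c p); last exact: cell_coordK.
  by apply/cell_faceP; [apply: cell_coord_unit|rewrite cell_coordK].
by apply/IP/cell_faceP => //; case: Hu.
Qed.

Lemma stair_intrinsic p q :
  (mdist p q)%:E = ereal_inf [set l%:E | l in string (@cell_chart R) p q].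
Proof.
have [ne lb] := str_has_inf p q; rewrite mdistE /sd ereal_inf_EFin //.
Qed.

Definition stair_complex : cubical_complex (stair R) :=
  CubicalComplex cell_cover cell_chart_inj cell_glue cell_faces stair_intrinsic.

Lemma stair_cellE c : cell (K := stair_complex) c = [set p | incell c p].
Proof. exact: cell_image. Qed.

Lemma stair_locally_finite : locally_finite stair_complex.
Proof.
move=> p.
pose G (z : nat * nat * (bool * bool)) : set (stair R) :=
  [set q | z.1.1%:R <= q.1 <= (z.1.1 + z.2.1)%:R /\
           z.1.2%:R <= q.2 <= (z.1.2 + z.2.2)%:R].
apply: (@sub_finite_set _ _ (G @` (`I_(Num.truncn p.1).+1 `*`
    `I_(Num.truncn p.2).+1 `*` setT))).
  move=> A [[c ->]]; rewrite stair_cellE => -[/andP[H1 _] /andP[H2 _]].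
  exists ((col_of c, row_of c), (is_wide c, is_tall c)) => //.
  by do 2 split => //=; rewrite ltnS truncn_ge_nat ?pt1_ge0 ?pt2_ge0.
apply: finite_image; apply: finite_setX; first by apply: finite_setX.
exact: finite_finset.
Qed.

Lemma stair_two_dimensional : two_dimensional stair_complex.
Proof.
split => [c|]; first by rewrite /= /cell_dim; case: is_wide; case: is_tall.
by exists (box (ht_gt0 0)).
Qed.

Lemma stair_origin_vertex : is_vertex stair_complex (origin R).
Proof.
exists (@GridCell 0 0 false false isT); split => //; rewrite stair_cellE.
apply/seteqP; split => [p [/= A B]|_ ->]; last by rewrite /incell /= !lexx.
apply: pt_inj; move: A B; rewrite -!eq_le => /eqP A /eqP B.
by rewrite (surjective_pairing (pt p)) -A -B.
Qed.

End Complex.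

(** * Half-spaces, hyperplanes and profiles *)

Section HalfSpaces.
Variable R : realType.
Implicit Types (p q z : stair R) (P N H C : set (stair R)) (n k : nat).

Lemma stair_open P : (forall p, P p ->
  exists2 e, 0 < e & forall q, sd p q < e -> P q) -> open P.
Proof.
move=> H; rewrite openE => p /H[e e0 He]; rewrite /interior -nbhs_ballE.
by exists e => //= q; rewrite ballEmdist /= mdistE => /He.
Qed.

Lemma open_gt1 (c : R) : open [set p : stair R | c < p.1].
Proof.
apply: stair_open => p /= cp; exists (p.1 - c); first by rewrite subr_gt0.
move=> q; have := le_sd1 p q; rewrite ler_norml => /andP[_]; lra.
Qed.

Lemma open_lt1 (c : R) : open [set p : stair R | p.1 < c].
Proof.
apply: stair_open => p /= cp; exists (c - p.1); first by rewrite subr_gt0.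
move=> q; have := le_sd1 p q; rewrite ler_norml => /andP[]; lra.
Qed.

Lemma open_gt2 (c : R) : open [set p : stair R | c < p.2].
Proof.
apply: stair_open => p /= cp; exists (p.2 - c); first by rewrite subr_gt0.
move=> q; have := le_sd2 p q; rewrite ler_norml => /andP[_]; lra.
Qed.

Lemma open_lt2 (c : R) : open [set p : stair R | p.2 < c].
Proof.
apply: stair_open => p /= cp; exists (c - p.2); first by rewrite subr_gt0.
move=> q; have := le_sd2 p q; rewrite ler_norml => /andP[]; lra.
Qed.

(** [P] is a whole component of the complement: it is connected, open, and relatively closed because
    [N] is open. *)
Lemma half_space_plusE O H P N : ~` H = P `|` N -> P `&` N = set0 ->
  open P -> open N -> connected P -> connected N -> N O ->
  half_space_plus O H = P.
Proof.
move=> HPN PN oP oN cP cN NO.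
have subP : P `<=` ~` H by rewrite HPN; left.
have subN : N `<=` ~` H by rewrite HPN; right.
have compP x : P x -> connected_component (~` H) x = P.
  move=> Px; apply/seteqP; split; last exact: connected_component_max.
  set A := connected_component _ _.
  have Ax : A x by apply: connected_component_refl; apply: subP.
  have AH : A `<=` ~` H := @connected_component_sub _ _ _.
  suff <- : A `&` P = A by move=> y [].
  apply: (@component_connected _ (~` H) x).
  - by exists x.
  - by exists P.
  - exists (~` N); first exact: open_closedC.
    apply/seteqP; split => y [Ay] Hy; split => //.
      by move=> Ny; have : (P `&` N) y by []; rewrite PN.
    by have := AH _ Ay; rewrite HPN => -[].
apply/seteqP; split => [y [S [[x Hx ->]]]|y Py].
  have : (P `|` N) x by rewrite -HPN.
  move=> [/compP->//|Nx] []; apply: (connected_component_max Nx subN cN NO).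
exists P => //; split; first by exists y; [apply: subP|rewrite compP].
by move=> PO; have : (P `&` N) O by []; rewrite PN.
Qed.

(** * Connectedness of the half-spaces *)

Definition joined P p q := exists C, [/\ connected C, C p, C q & C `<=` P].

Lemma joined_sym P p q : joined P p q -> joined P q p.
Proof. by move=> [C [? ? ? ?]]; exists C. Qed.

Lemma joined_trans P q p z : joined P p q -> joined P q z -> joined P p z.
Proof.
move=> [C [C1 C2 C3 C4]] [D [D1 D2 D3 D4]]; exists (C `|` D); split.
- by apply: connectedU => //; exists q.
- by left.
- by right.
- by move=> x [/C4|/D4].
Qed.

Lemma joined_connected P x : (forall p, P p -> joined P x p) -> connected P.
Proof.
move=> H.
have -> : P = \bigcup_(C in [set C | [/\ connected C, C x & C `<=` P]]) C.
  apply/seteqP; split => [p /H[C [C1 C2 C3 C4]]|p [C [_ _ CP] Cp]].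
    by exists C.
  exact: CP.
by apply: bigcup_connected => [|C []//]; exists x => C [].
Qed.

Lemma lipschitz_path_connected (f : R -> stair R) (a b : R) :
  (forall s t, sd (f s) (f t) <= `|s - t|) -> connected (f @` `[a, b]).
Proof.
move=> H; apply: connected_continuous_connected; first exact: segment_connected.
apply: continuous_subspaceT => t; apply/cvg_ballP => e e0.
near=> s; rewrite ballEmdist /= mdistE; apply: le_lt_trans (H _ _) _.
by near: s; apply: (@cvgr_dist_lt _ _ _ (nbhs t) _ id t).
Unshelve. all: by end_near.
Qed.

Lemma joined_horizontal P p q : p.1 <= q.1 -> p.2 = q.2 ->
  (forall z, p.1 <= z.1 <= q.1 -> z.2 = p.2 -> P z) -> joined P p q.
Proof.
move=> pq1 pq2 HP; pose f t := insubd p (clamp p.1 q.1 t, p.2).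
have fE t : (f t : R * R) = (clamp p.1 q.1 t, p.2).
  rewrite insubdK //; apply: region_right.
  by have /andP[] := clampP t pq1.
exists (f @` `[p.1, q.1]); split.
- apply: lipschitz_path_connected => s t.
  by rewrite sd_horizontal !fE //; apply: clamp_lipschitz.
- exists p.1; first by rewrite /= in_itv /= lexx.
  by apply: pt_inj; rewrite fE clamp_id ?lexx //; case: (pt p).
- exists q.1; first by rewrite /= in_itv /= lexx andbT.
  by apply: pt_inj; rewrite fE clamp_id ?lexx ?andbT // pq2; case: (pt q).
- by move=> _ [t _ <-]; apply: HP; rewrite fE //=; apply: clampP.
Qed.

Lemma joined_vertical P p q : p.1 = q.1 -> p.2 <= q.2 ->
  (forall z, z.1 = p.1 -> p.2 <= z.2 <= q.2 -> P z) -> joined P p q.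
Proof.
move=> pq1 pq2 HP; pose f t := insubd p (p.1, clamp p.2 q.2 t).
have fE t : (f t : R * R) = (p.1, clamp p.2 q.2 t).
  rewrite insubdK // pq1; apply: region_down.
  by have /andP[A ->] := clampP t pq2; rewrite andbT (le_trans _ A) ?pt2_ge0.
exists (f @` `[p.2, q.2]); split.
- apply: lipschitz_path_connected => s t.
  by rewrite sd_vertical !fE //; apply: clamp_lipschitz.
- exists p.2; first by rewrite /= in_itv /= lexx.
  by apply: pt_inj; rewrite fE clamp_id ?lexx //; case: (pt p).
- exists q.2; first by rewrite /= in_itv /= lexx andbT.
  by apply: pt_inj; rewrite fE clamp_id ?lexx ?andbT // pq1; case: (pt q).
- by move=> _ [t _ <-]; apply: HP; rewrite fE //=; apply: clampP.
Qed.

Lemma joined_floor P p : (forall z, z.1 = p.1 -> z.2 <= p.2 -> P z) ->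
  joined P p (floor_pt p.1).
Proof.
move=> HP; apply: joined_sym; apply: joined_vertical.
- by rewrite floor_ptE ?pt1_ge0.
- by rewrite floor_ptE ?pt1_ge0 //= pt2_ge0.
- by move=> z; rewrite floor_ptE ?pt1_ge0 //= => E /andP[_ ?]; apply: HP.
Qed.

Lemma joined_floors P (s t : R) : 0 <= s -> s <= t ->
  (forall z, s <= z.1 <= t -> z.2 = 0 -> P z) ->
  joined P (floor_pt s) (floor_pt t).
Proof.
move=> s0 st HP; have t0 := le_trans s0 st.
by apply: joined_horizontal; rewrite !floor_ptE //= => z; apply: HP.
Qed.

Lemma connected_gt1 (c : R) : 0 <= c -> connected [set p : stair R | c < p.1].
Proof.
move=> c0; apply: (@joined_connected _ (floor_pt (c + 1))) => p /= cp.
apply: joined_sym; apply: (@joined_trans _ (floor_pt p.1)).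
  by apply: joined_floor => z /= -> _.
case: (leP p.1 (c + 1)) => h.
  apply: joined_floors => //; first by lra.
  by move=> z /andP[? _] _ /=; lra.
apply: joined_sym; apply: joined_floors; [lra|exact: ltW|].
by move=> z /andP[? _] _ /=; lra.
Qed.

Lemma connected_lt1 (c : R) : connected [set p : stair R | p.1 < c].
Proof.
apply: (@joined_connected _ (floor_pt 0)) => p /= cp.
apply: joined_sym; apply: (@joined_trans _ (floor_pt p.1)).
  by apply: joined_floor => z /= -> _.
apply: joined_sym; apply: joined_floors => //; first exact: pt1_ge0.
by move=> z /andP[_ ?] _ /=; lra.
Qed.

Lemma connected_lt2 (c : R) : connected [set p : stair R | p.2 < c].
Proof.
apply: (@joined_connected _ (floor_pt 0)) => p /= cp.
apply: joined_sym; apply: (@joined_trans _ (floor_pt p.1)).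
  by apply: joined_floor => z _ /= ?; lra.
apply: joined_sym; apply: joined_floors => //; first exact: pt1_ge0.
by move=> z _ /= ->; apply: le_lt_trans cp; apply: pt2_ge0.
Qed.

(** Here the floor cannot be used: both points are moved right to a common abscissa and joined there
    vertically. *)
Lemma connected_gt2 (c : R) : connected [set p : stair R | c < p.2].
Proof.
have [->|/set0P[x /= cx]] := eqVneq [set p : stair R | c < p.2] set0.
  exact: connected0.
apply: (@joined_connected _ x) => p /= cp.
pose X := Num.max x.1 p.1.
have xX : x.1 <= X by rewrite le_max lexx.
have pX : p.1 <= X by rewrite le_max lexx orbT.
pose x' := Stair (region_right xX); pose p' := Stair (region_right pX).
apply: (@joined_trans _ x').
  by apply: joined_horizontal => // z _ /= ->.
apply: joined_sym; apply: (@joined_trans _ p').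
  by apply: joined_horizontal => // z _ /= ->.
case: (leP x.2 p.2) => h.
  by apply: joined_sym; apply: joined_vertical => // z _ /= /andP[? _]; lra.
by apply: joined_vertical => //=; [exact: ltW|move=> z _ /andP[? _]; lra].
Qed.

Definition vertical_hyp n : set (stair R) := [set p | p.1 = n%:R + 2^-1].
Definition horizontal_hyp k : set (stair R) := [set p | p.2 = k%:R + 2^-1].

Lemma vertical_plus n :
  half_space_plus (origin R) (vertical_hyp n) = [set p | n%:R + 2^-1 < p.1].
Proof.
have n0 : 0 <= n%:R :> R by [].
apply: (@half_space_plusE _ _ _ [set p | p.1 < n%:R + 2^-1]).
- apply/seteqP; split => p /=; rewrite /vertical_hyp /=.
    by move=> /eqP; rewrite neq_lt => /orP[]; [right|left].
  by move=> H E; case: H; rewrite E ltxx.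
- by apply/seteqP; split => p //= [/lt_trans H /H]; rewrite ltxx.
- exact: open_gt1.
- exact: open_lt1.
- by apply: connected_gt1; lra.
- exact: connected_lt1.
- by rewrite /=; lra.
Qed.

Lemma horizontal_plus k :
  half_space_plus (origin R) (horizontal_hyp k) = [set p | k%:R + 2^-1 < p.2].
Proof.
have k0 : 0 <= k%:R :> R by [].
apply: (@half_space_plusE _ _ _ [set p | p.2 < k%:R + 2^-1]).
- apply/seteqP; split => p /=; rewrite /horizontal_hyp /=.
    by move=> /eqP; rewrite neq_lt => /orP[]; [right|left].
  by move=> H E; case: H; rewrite E ltxx.
- by apply/seteqP; split => p //= [/lt_trans H /H]; rewrite ltxx.
- exact: open_gt2.
- exact: open_lt2.
- exact: connected_gt2.
- exact: connected_lt2.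
- by rewrite /=; lra.
Qed.

End HalfSpaces.

(** * Hyperplanes as grid lines *)

Section Hyperplanes.
Variable R : realType.
Implicit Types (p q z : stair R) (A B H C : set (stair R)) (n k : nat)
  (c : grid_cell).

Notation K := (stair_complex R).
Notation V := (@vertical_hyp R).
Notation W := (@horizontal_hyp R).

Definition vertical_mid c := [set p | incell c p] `&` V (col_of c).
Definition horizontal_mid c := [set p | incell c p] `&` W (row_of c).

Lemma sum_half (b : bool) (v : 'I_b -> R) (j : 'I_b) :
  (v j = 2^-1) <-> \sum_i v i = 2^-1.
Proof. by case: b v j => v j; [rewrite big_ord1 (ord1 j)|case: j]. Qed.

Lemma midcubeE (c : cube K) (i : 'I_(cell_dim c)) :
  match fintype.split i with
  | inl _ => midcube (K := K) i = vertical_mid c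
  | inr _ => midcube (K := K) i = horizontal_mid c
  end.
Proof.
case: fintype.splitP => j ij.
  have {ij} -> : i = lshift _ j by apply: val_inj.
  apply/seteqP; split => [_ [u [U Hu] <-]|p [Hp Hv]].
    split; first exact: incell_chart.
    rewrite /vertical_hyp /= cell_chartE //=; congr (_ + _).
    by apply/(sum_half (lsubmx u ord0) j); rewrite mxE.
  exists (cell_coord c p); last exact: cell_coordK.
  split; first exact: cell_coord_unit.
  by rewrite /cell_coord row_mxEl mxE Hv addrAC subrr add0r.
have {ij} -> : i = rshift _ j by apply: val_inj.
apply/seteqP; split => [_ [u [U Hu] <-]|p [Hp Hv]].
  split; first exact: incell_chart.
  rewrite /horizontal_hyp /= cell_chartE //=; congr (_ + _).
  by apply/(sum_half (rsubmx u ord0) j); rewrite mxE.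
exists (cell_coord c p); last exact: cell_coordK.
split; first exact: cell_coord_unit.
by rewrite /cell_coord row_mxEr mxE Hv addrAC subrr add0r.
Qed.

Lemma midcube_cases A : is_midcube K A ->
  (exists2 c, is_wide c & A = vertical_mid c) \/
  (exists2 c, is_tall c & A = horizontal_mid c).
Proof.
move=> [c [i ->]]; have := midcubeE i.
case: fintype.splitP => j _ E; [left|right]; exists c => //.
  by case: (is_wide c) j => // -[].
by case: (is_tall c) j => // -[].
Qed.

Lemma vertical_midcube c : is_wide c -> is_midcube K (vertical_mid c).
Proof.
move=> w; have j : 'I_(is_wide c) by rewrite w; exact: ord0.
exists c, (lshift _ j : 'I_(cell_dim c)).
by have := midcubeE (lshift _ j : 'I_(cell_dim c)); rewrite (unsplitK (inl j)).
Qed.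

Lemma horizontal_midcube c : is_tall c -> is_midcube K (horizontal_mid c).
Proof.
move=> w; have j : 'I_(is_tall c) by rewrite w; exact: ord0.
exists c, (rshift _ j : 'I_(cell_dim c)).
by have := midcubeE (rshift _ j : 'I_(cell_dim c)); rewrite (unsplitK (inr j)).
Qed.

Lemma half_not_nat n k : n%:R <> k%:R + 2^-1 :> R.
Proof.
move=> E; have : (2 * n)%:R = (2 * k + 1)%:R :> R.
  by rewrite natrD !natrM E mulrDr divff.
by move=> /eqP; rewrite eqr_nat => /eqP; lia.
Qed.

Lemma vertical_mid_point c : is_wide c -> exists2 p : stair R, vertical_mid c p &
  (p : R * R) = ((col_of c)%:R + 2^-1, (row_of c)%:R).
Proof.
move=> w; have r : (row_of c <= ht (col_of c))%N.
  by apply: leq_trans (grid_cellP c); apply: leq_addr.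
have [||p E _] := @incol_exists R (col_of c) ((col_of c)%:R + 2^-1) (row_of c)%:R.
- by rewrite -[(col_of c).+1%:R]natr1; apply/andP; split; lra.
- by rewrite ler0n ler_nat.
exists p => //; split; rewrite /= ?/vertical_hyp ?/incell /= E //=.
rewrite w !ler_nat leqnn leq_addr addn1 -[(col_of c).+1%:R]natr1; split => //.
by apply/andP; split; lra.
Qed.

Lemma horizontal_mid_point c : is_tall c -> exists2 p : stair R,
  horizontal_mid c p & (p : R * R) = ((col_of c)%:R, (row_of c)%:R + 2^-1).
Proof.
move=> w; have := grid_cellP c; rewrite w addn1 => r.
have r' : (row_of c).+1%:R <= (ht (col_of c))%:R :> R by rewrite ler_nat.
have r0 : 0 <= (row_of c)%:R :> R by [].
have [||p E _] := @incol_exists R (col_of c) (col_of c)%:R ((row_of c)%:R + 2^-1).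
- by rewrite lexx ler_nat /=.
- by rewrite -[(row_of c).+1%:R]natr1 in r'; apply/andP; split; lra.
exists p => //; split; rewrite /= ?/horizontal_hyp ?/incell /= E //=.
rewrite w !ler_nat leqnn leq_addr addn1 -[(row_of c).+1%:R]natr1; split => //.
by apply/andP; split; lra.
Qed.

(** Every midcube has a point with one half-integral and one integral coordinate. The first fixes
    the position of a larger midcube, the second rules out the other direction. Inclusion in [V n]
    is thus constant on each class. *)
Lemma face_vertical n A B : midcube_face K A B -> A `<=` V n <-> B `<=` V n.
Proof.
move=> [MA MB AB]; split => [AV|BV]; last exact: subset_trans BV.
case: (midcube_cases MA) => -[c wc EA]; last first.
  have [p Hp pE] := horizontal_mid_point wc.
  have := AV p; rewrite EA /vertical_hyp /= pE => /(_ Hp) /half_not_nat [].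
have [p Hp pE] := vertical_mid_point wc.
have Ap : A p by rewrite EA.
have pn := AV p Ap; case: (midcube_cases MB) => -[c' wc' EB]; last first.
  have := AB p Ap; rewrite EB => -[_]; rewrite /horizontal_hyp /= pE.
  by move=> /half_not_nat [].
have := AB p Ap; rewrite EB => -[_] pc' q [_].
by move: pc' pn; rewrite /vertical_hyp /= => -> /addIr ->.
Qed.

Lemma face_horizontal n A B : midcube_face K A B -> A `<=` W n <-> B `<=` W n.
Proof.
move=> [MA MB AB]; split => [AV|BV]; last exact: subset_trans BV.
case: (midcube_cases MA) => -[c wc EA].
  have [p Hp pE] := vertical_mid_point wc.
  have := AV p; rewrite EA /horizontal_hyp /= pE => /(_ Hp) /half_not_nat [].
have [p Hp pE] := horizontal_mid_point wc.
have Ap : A p by rewrite EA.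
have pn := AV p Ap; case: (midcube_cases MB) => -[c' wc' EB].
  have := AB p Ap; rewrite EB => -[_]; rewrite /vertical_hyp /= pE.
  by move=> /half_not_nat [].
have := AB p Ap; rewrite EB => -[_] pc' q [_].
by move: pc' pn; rewrite /horizontal_hyp /= => -> /addIr ->.
Qed.

Notation equiv := (clos_refl_sym_trans _ (midcube_face K)).

Lemma equiv_invariant (P : set (stair R) -> Prop) :
  (forall A B, midcube_face K A B -> P A <-> P B) ->
  forall A B, equiv A B -> P A <-> P B.
Proof.
by move=> H A B; elim=> // [{}A {}B _ ->|{}A {}B C _ -> _ ->].
Qed.

Lemma incell_sub c c' : (col_of c' <= col_of c)%N ->
  (col_of c + is_wide c <= col_of c' + is_wide c')%N ->
  (row_of c' <= row_of c)%N ->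
  (row_of c + is_tall c <= row_of c' + is_tall c')%N ->
  [set p : stair R | incell c p] `<=` [set p | incell c' p].
Proof.
move=> H1 H2 H3 H4 p [/andP[A1 A2] /andP[A3 A4]].
by split; apply/andP; split; [apply: le_trans A1|apply: le_trans A2 _|
  apply: le_trans A3|apply: le_trans A4 _]; rewrite ler_nat.
Qed.

Lemma h_edgeP n k : (k <= ht n)%N -> (k + false <= ht n)%N.
Proof. by rewrite addn0. Qed.

Definition h_edge n k (H : (k <= ht n)%N) := @GridCell n k true false (h_edgeP H).
Definition v_edge n k (H : (k < ht n)%N) := @GridCell n k false true (ht_box H).

(** Consecutive horizontal edges of a column are opposite sides of a box, so their midpoints are
    faces of the same midcube. *)
Lemma vertical_edges n k (H : (k <= ht n)%N) :
  equiv (vertical_mid (h_edge (leq0n (ht n)))) (vertical_mid (h_edge H)).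
Proof.
elim: k H => [|k IH] H.
  by rewrite (bool_irrelevance (leq0n (ht n)) H); apply: rst_refl.
have H' := ltnW H; apply: rst_trans (IH H') _.
apply: (@rst_trans _ _ _ (vertical_mid (box H))).
  apply: rst_step; split; try exact: vertical_midcube.
  by apply: setSI; apply: incell_sub => /=; lia.
apply: rst_sym; apply: rst_step; split; try exact: vertical_midcube.
by apply: setSI; apply: incell_sub => /=; lia.
Qed.

Lemma vertical_equiv c : is_wide c ->
  equiv (vertical_mid (h_edge (leq0n (ht (col_of c))))) (vertical_mid c).
Proof.
move=> w; have H : (row_of c <= ht (col_of c))%N.
  by apply: leq_trans (grid_cellP c); apply: leq_addr.
apply: rst_trans (vertical_edges H) _; apply: rst_step.
split; try exact: vertical_midcube.
by apply: setSI; apply: incell_sub => //=; rewrite ?w // addn0 leq_addr.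
Qed.

(** To the right no box of row [k] is missing, as [ht] is nondecreasing. *)
Lemma horizontal_edges n m k (Hn : (k < ht n)%N) (Hm : (k < ht (n + m))%N) :
  equiv (horizontal_mid (v_edge Hn)) (horizontal_mid (v_edge Hm)).
Proof.
elim: m Hm => [|m IH] Hm.
  move: Hm; rewrite addn0 => Hm; rewrite (bool_irrelevance Hm Hn).
  exact: rst_refl.
have H' : (k < ht (n + m))%N by apply: (leq_trans Hn); apply: leq_ht; lia.
apply: rst_trans (IH H') _.
apply: (@rst_trans _ _ _ (horizontal_mid (box H'))).
  apply: rst_step; split; try exact: horizontal_midcube.
  by apply: setSI; apply: incell_sub => /=; lia.
apply: rst_sym; apply: rst_step; split; try exact: horizontal_midcube.
by apply: setSI; apply: incell_sub => /=; lia.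
Qed.

Lemma tall_row c : is_tall c -> (row_of c < ht (col_of c))%N.
Proof. by move=> w; have := grid_cellP c; rewrite w addn1. Qed.

Lemma horizontal_equiv_edge c (w : is_tall c) :
  equiv (horizontal_mid (v_edge (tall_row w))) (horizontal_mid c).
Proof.
apply: rst_step; split; try exact: horizontal_midcube.
by apply: setSI; apply: incell_sub => //=; rewrite ?w // addn0 leq_addr.
Qed.

Lemma horizontal_equiv c c' : is_tall c -> is_tall c' -> row_of c = row_of c' ->
  equiv (horizontal_mid c) (horizontal_mid c').
Proof.
move=> w w' E.
wlog le : c c' w w' E / (col_of c <= col_of c')%N.
  move=> X; case: (leqP (col_of c) (col_of c')) => h; first exact: X.
  by apply: rst_sym; apply: X => //; apply: ltnW.
apply: rst_trans (rst_sym _ _ _ _ (horizontal_equiv_edge w)) _.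
apply: rst_trans (horizontal_equiv_edge w').
have H := tall_row w'; have -> : tall_row w' = H by apply: bool_irrelevance.
move: H; rewrite -E -(subnKC le) => H; exact: horizontal_edges.
Qed.

Lemma vertical_class c : is_wide c ->
  \bigcup_(B in equiv (vertical_mid c)) B = V (col_of c).
Proof.
move=> w; apply/seteqP; split => [p [B /= AB Bp]|p Vp].
  have I := equiv_invariant (@face_vertical (col_of c)) AB.
  by apply: (I.1 _ p Bp) => q [].
have Hp : incol (col_of c) p.
  have c0 : 0 <= (col_of c)%:R :> R by [].
  rewrite /incol lt_inL ?andbT Vp ?lerDl //.
  by rewrite -[(col_of c).+1%:R]natr1; lra.
have [k [H I]] := incell_box_exists Hp.
exists (vertical_mid (box H)); last by split.
apply: rst_trans (rst_sym _ _ _ _ (vertical_equiv w)) _.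
exact: (@vertical_equiv (box H)).
Qed.

Lemma horizontal_class c : is_tall c ->
  \bigcup_(B in equiv (horizontal_mid c)) B = W (row_of c).
Proof.
move=> w; apply/seteqP; split => [p [B /= AB Bp]|p Wp].
  have I := equiv_invariant (@face_horizontal (row_of c)) AB.
  by apply: (I.1 _ p Bp) => q [].
have [k [H I]] := incell_box_exists (incol_truncn p).
have E : row_of c = k.
  case: I => _ /=; rewrite Wp addn1 -[k.+1%:R]natr1 => /andP[A B].
  have A' : k%:R < (row_of c).+1%:R :> R by rewrite -[(row_of c).+1%:R]natr1; lra.
  have B' : (row_of c)%:R < k.+1%:R :> R by rewrite -[k.+1%:R]natr1; lra.
  by move: A' B'; rewrite !ltr_nat; lia.
exists (horizontal_mid (box H)); last by split=> //; rewrite /= -E.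
exact: (@horizontal_equiv c (box H)).
Qed.

Lemma hyperplane_cases H : hyperplane K H ->
  (exists n, H = V n) \/ (exists k, H = W k).
Proof.
move=> [A /midcube_cases [[c w ->]|[c w ->]] ->]; [left|right].
  by exists (col_of c); apply: vertical_class.
by exists (row_of c); apply: horizontal_class.
Qed.

Lemma vertical_hyperplane n : hyperplane K (V n).
Proof.
exists (vertical_mid (h_edge (leq0n (ht n)))); first exact: vertical_midcube.
by rewrite vertical_class.
Qed.

Lemma horizontal_hyperplane k : hyperplane K (W k).
Proof.
have [n Hn] := ht_unbounded k.+1.
exists (horizontal_mid (v_edge Hn)); first exact: horizontal_midcube.
by rewrite horizontal_class.
Qed.

(** * The order on hyperplanes and the profiles *)

Notation le := (hyperplane_le (origin R)).

Lemma vertical_le n m : (n <= m)%N -> le (V n) (V m).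
Proof.
rewrite /hyperplane_le !vertical_plus => nm p /=; apply: le_lt_trans.
by rewrite lerD2r ler_nat.
Qed.

Lemma horizontal_le n m : (n <= m)%N -> le (W n) (W m).
Proof.
rewrite /hyperplane_le !horizontal_plus => nm p /=; apply: le_lt_trans.
by rewrite lerD2r ler_nat.
Qed.

(** A point higher than [ht n] lies to the right of column [n]. *)
Lemma vertical_horizontal_le n k : (ht n <= k)%N -> le (V n) (W k).
Proof.
rewrite /hyperplane_le vertical_plus horizontal_plus => nk p /= kp.
have /and3P[p0 _ p2] := ptP p.
have : (k < ht (Num.truncn p.1))%N.
  rewrite -(ltr_nat R); apply: lt_le_trans p2; apply: le_lt_trans kp.
  by rewrite lerDl.
move=> /(leq_ltn_trans nk) h.
have : (n < Num.truncn p.1)%N.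
  by rewrite ltnNge; apply/negP => /leq_ht; rewrite leqNgt h.
rewrite truncn_ge_nat // -[n.+1%:R]natr1; lra.
Qed.

(** The floor passes every vertical line while staying below all horizontal ones. *)
Lemma not_horizontal_vertical_le n k : ~ le (W k) (V n).
Proof.
rewrite /hyperplane_le vertical_plus horizontal_plus.
have k0 : 0 <= k%:R :> R by [].
move=> /(_ (floor_pt n.+1%:R)) /=; rewrite floor_ptE //= -[n.+1%:R]natr1 => H.
have : k%:R + 2^-1 < 0 :> R by apply: H; lra.
by lra.
Qed.

Lemma vertical_le_inv n m : le (V n) (V m) -> (n <= m)%N.
Proof.
rewrite /hyperplane_le !vertical_plus => /(_ (floor_pt m.+1%:R)) /=.
rewrite floor_ptE //= -[m.+1%:R]natr1 => H.
have : n%:R + 2^-1 < m%:R + 1 :> R by apply: H; lra.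
move=> {}H; have : n%:R < m.+1%:R :> R by rewrite -[m.+1%:R]natr1; lra.
by rewrite ltr_nat.
Qed.

Lemma horizontal_le_inv n m : le (W n) (W m) -> (n <= m)%N.
Proof.
rewrite /hyperplane_le !horizontal_plus.
have [i Hi] := ht_unbounded m.+1.
have [||p E _] := @incol_exists R i i%:R m.+1%:R.
- by rewrite lexx ler_nat /=.
- by rewrite ler0n ler_nat.
move=> /(_ p) /=; rewrite E /= -[m.+1%:R]natr1 => H.
have : n%:R + 2^-1 < m%:R + 1 :> R by apply: H; lra.
move=> {}H; have : n%:R < m.+1%:R :> R by rewrite -[m.+1%:R]natr1; lra.
by rewrite ltr_nat.
Qed.

Lemma le_refl H : le H H.
Proof. by []. Qed.

Lemma vertical_neq_horizontal n k : V n <> W k.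
Proof.
by move=> E; apply: (@not_horizontal_vertical_le n k); rewrite E; apply: le_refl.
Qed.

Definition verticals : set (set (stair R)) := [set H | exists n, H = V n].
Definition horizontals : set (set (stair R)) := [set H | exists k, H = W k].

(** Each half-space contains a far quadrant, so finitely many share the point [(N, ht N)] for a
    large [N]. *)
Lemma plus_far H : (verticals `|` horizontals) H -> exists N, forall p,
  N%:R <= p.1 -> (ht N)%:R <= p.2 -> half_space_plus (origin R) H p.
Proof.
move=> [[n ->]|[k ->]].
  exists n.+1 => p; rewrite vertical_plus /= -[n.+1%:R]natr1 => ? _; lra.
have [N HN] := ht_unbounded k.+1; exists N => p _; rewrite horizontal_plus /=.
by apply: lt_le_trans; move: HN; rewrite -(ler_nat R) -[k.+1%:R]natr1; lra.
Qed.

Lemma finite_hyperplanes_meet (F : set (set (stair R))) : finite_set F ->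
  F `<=` verticals `|` horizontals ->
  \bigcap_(H in F) half_space_plus (origin R) H !=set0.
Proof.
move=> /finite_seqP[s ->] FVW.
have [N HN] : exists N, forall p, N%:R <= p.1 -> (ht N)%:R <= p.2 ->
    forall H, H \in s -> half_space_plus (origin R) H p.
  elim: s FVW => [|A s IH] FVW; first by exists 0%N.
  have [|N1 H1] := IH; first by move=> H Hs; apply: FVW; rewrite /= inE Hs orbT.
  have [N2 H2] := plus_far (FVW A (mem_head _ _)).
  exists (maxn N1 N2) => p p1 p2 H; rewrite inE => /orP[/eqP ->|].
    apply: H2; [apply: le_trans p1|apply: le_trans p2]; rewrite ler_nat.
      exact: leq_maxr.
    by apply: leq_ht; apply: leq_maxr.
  apply: H1; [apply: le_trans p1|apply: le_trans p2]; rewrite ler_nat.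
    exact: leq_maxl.
  by apply: leq_ht; apply: leq_maxl.
have [||p E _] := @incol_exists R N N%:R (ht N)%:R.
- by rewrite lexx ler_nat /=.
- by rewrite ler0n lexx.
by exists p => H /= Hs; apply: HN; rewrite ?E.
Qed.

Lemma verticals_profile : profile K (origin R) verticals.
Proof.
split.
- split; first by exists (V 0), 0%N.
  by move=> H [n ->]; apply: vertical_hyperplane.
- move=> F fF FV; apply: finite_hyperplanes_meet => // H /FV; by left.
- move=> [H [n ->] Hmax].
  have E : V n.+1 = V n by apply: Hmax; [exists n.+1|apply: vertical_le].
  have : le (V n.+1) (V n) by rewrite E.
  by move/vertical_le_inv; rewrite ltnn.
- move=> H1 H2 [n ->] /hyperplane_cases[//|[k ->]].
  by move=> /not_horizontal_vertical_le.
Qed.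

Lemma all_profile : profile K (origin R) (verticals `|` horizontals).
Proof.
split.
- split; first by exists (V 0); left; exists 0%N.
  move=> H [[n ->]|[k ->]]; first exact: vertical_hyperplane.
  exact: horizontal_hyperplane.
- by move=> F fF FV; apply: finite_hyperplanes_meet.
- move=> [H [[n ->]|[n ->]] Hmax].
    have E : V n.+1 = V n.
      by apply: Hmax; [left; exists n.+1|apply: vertical_le].
    have : le (V n.+1) (V n) by rewrite E.
    by move/vertical_le_inv; rewrite ltnn.
  have E : W n.+1 = W n.
    by apply: Hmax; [right; exists n.+1|apply: horizontal_le].
  have : le (W n.+1) (W n) by rewrite E.
  by move/horizontal_le_inv; rewrite ltnn.
- by move=> H1 H2 _ /hyperplane_cases.
Qed.

(* Without maximal elements, a profile containing one member of an unbounded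
   chain contains arbitrarily large ones, hence the whole chain. *)
Lemma profile_cases P : profile K (origin R) P ->
  P = verticals \/ P = verticals `|` horizontals.
Proof.
move=> [[[H0 PH0] hypP] _ nomax down].
have bigger H : P H -> exists H', [/\ P H', le H H' & H' <> H].
  move=> PH; apply: contrapT => N; apply: nomax; exists H => // H' PH' HH'.
  by apply: contrapT => NE; apply: N; exists H'.
have [[k0 Wk0]|noW] := pselect (exists k, P (W k)).
  right.
  have chain j : exists2 k, (j <= k)%N & P (W k).
    elim: j => [|j [k jk PWk]]; first by exists k0.
    have [H' [PH' le' ne']] := bigger _ PWk.
    case: (hyperplane_cases (hypP _ PH')) => -[m Em]; rewrite Em in PH' le' ne'.
      by case: (not_horizontal_vertical_le le').
    exists m => //; apply: leq_ltn_trans jk _.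
    rewrite ltn_neqAle (horizontal_le_inv le') andbT.
    by apply/negP => /eqP km; apply: ne'; rewrite km.
  apply/seteqP; split => [H PH|H]; first by have := hyperplane_cases (hypP _ PH).
  move=> [[n ->]|[n ->]].
    (* A horizontal line of index at least [ht n] is above [V n], so downward closure brings in all
       verticals. *)
    have [k nk PWk] := chain (ht n); apply: down PWk _ _.
      exact: vertical_hyperplane.
    exact: vertical_horizontal_le.
  have [k nk PWk] := chain n; apply: down PWk _ _.
    exact: horizontal_hyperplane.
  exact: horizontal_le.
left.
have PV H : P H -> exists n, H = V n.
  move=> PH; case: (hyperplane_cases (hypP _ PH)) => [//|[k E]].
  by case: noW; exists k; rewrite -E.
have chain j : exists2 k, (j <= k)%N & P (V k).
  elim: j => [|j [k jk PVk]].
    by have [n E] := PV _ PH0; exists n => //; rewrite -E.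
  have [H' [PH' le' ne']] := bigger _ PVk.
  have [m Em] := PV _ PH'; rewrite Em in PH' le' ne'.
  exists m => //; apply: leq_ltn_trans jk _.
  rewrite ltn_neqAle (vertical_le_inv le') andbT.
  by apply/negP => /eqP km; apply: ne'; rewrite km.
apply/seteqP; split => [H /PV//|H [n ->]].
have [k nk PVk] := chain n; apply: down PVk _ _; first exact: vertical_hyperplane.
exact: vertical_le.
Qed.

Lemma profiles_stair : [set P | profile K (origin R) P] =
  [set verticals; verticals `|` horizontals].
Proof.
apply/seteqP; split => [P /profile_cases//|P [->|->]] /=.
  exact: verticals_profile.
exact: all_profile.
Qed.

Lemma card_profiles_stair : ([set P | profile K (origin R) P] #= `I_2)%card.
Proof.
rewrite profiles_stair; apply/eq_cardSP; exists verticals; first by left.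
have -> : [set verticals; verticals `|` horizontals] `\ verticals =
    [set verticals `|` horizontals]; last exact: card_set1.
apply/seteqP; split => [P [[->|//]]|P ->]; first by move=> [].
split; first by right.
move=> E; have : verticals (W 0) by rewrite -E; right; exists 0%N.
by move=> [n /esym /vertical_neq_horizontal].
Qed.

End Hyperplanes.

Local Open Scope card_scope.

Theorem mainTheorem7 (R : realType) :
  exists (M : metricType R) (K : cubical_complex M) (O : M),
    CAT0 M /\ locally_finite K /\ two_dimensional K /\ is_vertex K O /\
    [set P | profile K O P] #= `I_2 /\
    boundary_at_infinity M #= `I_1.
Proof.
exists (stair R), (stair_complex R), (origin R).
split; first exact: CAT0_stair.
split; first exact: stair_locally_finite.
split; first exact: stair_two_dimensional.
split; first exact: stair_origin_vertex.
split; first exact: card_profiles_stair.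
rewrite boundary_stair; exact: card_set1.
Qed.
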